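(* Let $a=(a_n)\in GM({}_6\beta,2)$. Then $$\|V_n(f)-S_n(f)\|=o(1)\ (n\to\infty)\quad\text{if and only if}\quad |a_n|\ln n=o(1)\ (n\to\infty).$$
   Context: $\mathbb{N}=\{1,2,\dots\}$ and $[t]$ is the integer part of $t$. For a nonnegative sequence $\beta=(\beta_n)$ and $r\in\mathbb{N}$, a sequence of complex numbers $(a_n)$ belongs to $GM(\beta,r)$ if there is a constant $C$ such that $\sum_{n=m}^{2m-1}|a_n-a_{n+r}|\le C\beta_m$ for all $m\in\mathbb{N}$. The class $GM({}_6\beta,r)$ consists of the sequences $a=(a_n)$ that satisfy this condition with $\beta_n={}_6\beta_n$, where for some $c>1$ (which may depend on the sequence $a$) $${}_6\beta_n=\frac1{\ln n}\max_{m\ge[n/c]}\left(\frac{\ln m}{m}\sum_{k=m}^{2m}|a_k|\right).$$ Here $n\ge2$, $m$ ranges over integers $m\ge\max(1,[n/c])$, the maximum is understood as a supremum, assumed finite, and the defining inequality of the class is required for indices $\ge2$ only. The norm is $\|F\|=\frac1{2\pi}\int_{-\pi}^{\pi}|F(x)|\,dx$. The symbol $f$ refers to the cosine series $\frac{a_0}{2}+\sum_{k=1}^{\infty}a_k\cos kx$ ($a_0\in\mathbb{C}$), with partial sums $S_n(f,x)=\frac{a_0}{2}+\sum_{k=1}^{n}a_k\cos kx$, and $V_n(f,x)=\frac1{n+1}\sum_{k=0}^{n}S_k(f,x)$. *)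

(* Defs.v *)
(* Standard-library reals with Coquelicot. *)
From Stdlib Require Import Reals ZArith.
From Coquelicot Require Import Coquelicot.
Open Scope R_scope.

(* [GM n0 beta r a] : the class GM(beta, r), with its defining inequality
   required for the indices m >= n0 (n0 = 1 for a beta defined on all of
   {1, 2, ...}, n0 = 2 for a beta defined only from 2 on). *)
Definition GM (n0 : nat) (beta : nat -> R) (r : nat) (a : nat -> C) : Prop :=
  exists K : R, forall m : nat, (n0 <= m)%nat ->
    sum_n_m (fun n => Cmod (a n - a (n + r)%nat)%C) m (2 * m - 1) <= K * beta m.

(* The set of values (ln m / m) * sum_(k=m)^(2m) |a_k| over the integers
   m >= max(1, [n/c]); [Int_part] is the floor. *)
Definition beta6_values (c : R) (a : nat -> C) (n : nat) : R -> Prop :=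
  fun y => exists m : nat,
    (1 <= m)%nat /\ (Int_part (INR n / c) <= Z.of_nat m)%Z /\
    y = ln (INR m) / INR m * sum_n_m (fun k => Cmod (a k)) m (2 * m).

Definition beta6_sup (c : R) (a : nat -> C) (n : nat) : Rbar :=
  Lub_Rbar (beta6_values c a n).

(* [real] sends the infinite values of the supremum to 0; [GM6] below requires
   the supremum to be finite. *)
Definition beta6 (c : R) (a : nat -> C) (n : nat) : R :=
  / ln (INR n) * real (beta6_sup c a n).

Definition GM6 (r : nat) (a : nat -> C) : Prop :=
  exists c : R, 1 < c /\
    (forall n : nat, (2 <= n)%nat -> is_finite (beta6_sup c a n)) /\
    GM 2 (beta6 c a) r a.

Definition S_cos (a : nat -> C) (n : nat) (x : R) : C :=
  (a 0%nat / 2 + sum_n_m (fun k => a k * cos (INR k * x)) 1 n)%C.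

Definition V_cos (a : nat -> C) (n : nat) (x : R) : C :=
  (/ (INR n + 1) * sum_n (fun k => S_cos a k x) n)%C.

(* A Riemann integral: it is only applied to continuous functions here. *)
Definition L1norm (F : R -> C) : R :=
  / (2 * PI) * RInt (fun x => Cmod (F x)) (- PI) PI.

(* Main.v *)
Require Import Defs.
From Stdlib Require Import Reals ZArith Lra Lia.
From Coquelicot Require Import Coquelicot.
Open Scope R_scope.

(** Up to sign, [V_n - S_n] is [1/(n+1)] times the sum of [k a_k cos kx] over
    [k <= n]. Write [T_m] for the sum of [|a_k - a_(k+2)|] over [m <= k < 2m],
    and [B_m] for [ln m / m] times the sum of [|a_k|] over [m <= k <= 2m]. The
    class GM6 bounds [T_m ln m] by a multiple of the supremum of [B_j] over
    [j >= [m/c]], so that [T_m ln m] is bounded, and tends to 0 as soon as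
    [B_m] does ([GM6_log_var], [GM6_log_var_lim]). Real and imaginary parts are
    treated separately ([L1norm_bounds]); let [p] be one of them and
    [b_k = k p_k].

    If [|a_n| ln n] tends to 0, then so do [B_m] and [T_m ln m]. Summation by
    parts with step 2 ([cos_poly_by_parts]) writes the cosine polynomial in
    terms of the kernels [sin(jx) / sin x], whose L1 norms are of order [ln j]
    ([RInt_U]), with coefficients [b_k - b_(k+2)]. Over the block [m, 2m) the
    sum of [|b_k - b_(k+2)|] is at most of order [m T_m + m B_m / ln m]
    ([block_var_le]), the logarithm of the kernel is absorbed, and the blocks
    add up to [o(n)] ([dyadic_sum]). This is [cos_poly_lim_of_log].

    Conversely, let the norms tend to 0. Testing the polynomial against
    [2 sin(nx)] times the sum of [sin(2ix)/i] over [i <= N], which is bounded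
    independently of [n] and [N] ([sine_sum_bounded]), shows that the sum of
    [b_(n-2i)/i] over [i <= N] is [o(n)] ([cos_poly_test]). Were all
    [b_(n-2i)] equal to [b_n], this would be [|b_n| ln N = o(n)]. The variation
    of [b] over a block, of order [m / ln m], is too large to say so for each
    single [n], but it suffices after averaging over [n] in [m, 2m]
    ([sum_abs_le_RInt]). Hence [B_m] tends to 0 ([log_mean_lim_of_cos_poly]),
    therefore [T_m ln m] does, and then the mean of [|a_k|] over a block
    controls each single term ([Cmod_log_le]). *)

(** * Finite sums *)

Lemma sumR_S (f : nat -> R) m n : (m <= S n)%nat ->
  sum_n_m f m (S n) = sum_n_m f m n + f (S n).
Proof. exact (sum_n_Sm f m n). Qed.

Lemma sumR_empty (f : nat -> R) m n : (n < m)%nat -> sum_n_m f m n = 0.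
Proof. exact (sum_n_m_zero f m n). Qed.

Lemma sumR_one (f : nat -> R) n : sum_n_m f n n = f n.
Proof. exact (sum_n_n f n). Qed.

(** Induction on the upper index of a sum from [m], starting where the range
    becomes nonempty. *)
Lemma sumR_ind (P : nat -> Prop) m :
  (forall n, (n < m)%nat -> P n) ->
  (forall n, (m <= S n)%nat -> P n -> P (S n)) ->
  (m = 0%nat -> P 0%nat) -> forall n, P n.
Proof.
intros H0 HS H00; induction n as [|n IH].
- destruct m as [|m]; [now apply H00|apply H0; lia].
- destruct (Nat.le_gt_cases m (S n)); [now apply HS|now apply H0].
Qed.

Ltac sum_induction m n :=
  pattern n; revert n; apply (sumR_ind _ m);
  [intros n Hn; rewrite ?(sumR_empty _ m n Hn)
  |intros n Hn IH; rewrite ?(sumR_S _ m n Hn)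
  |intros ->; rewrite ?sumR_one].

Lemma sumR_plus (f g : nat -> R) m n :
  sum_n_m (fun k => f k + g k) m n = sum_n_m f m n + sum_n_m g m n.
Proof. exact (sum_n_m_plus f g m n). Qed.

Lemma sumR_scal c (f : nat -> R) m n :
  sum_n_m (fun k => c * f k) m n = c * sum_n_m f m n.
Proof. exact (sum_n_m_mult_l (K := R_Ring) c f m n). Qed.

Lemma sumR_le (f g : nat -> R) m n :
  (forall k, (m <= k <= n)%nat -> f k <= g k) ->
  sum_n_m f m n <= sum_n_m g m n.
Proof.
sum_induction m n; intros H.
- lra.
- apply Rplus_le_compat; [apply IH; intros; apply H|apply H]; lia.
- apply H; lia.
Qed.

Lemma sumR_ge0 (f : nat -> R) m n :
  (forall k, (m <= k <= n)%nat -> 0 <= f k) -> 0 <= sum_n_m f m n.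
Proof.
intros H; rewrite <- (Rmult_0_r (INR (S n - m))), <- sum_n_m_const.
now apply sumR_le.
Qed.

Lemma sumR_abs (f : nat -> R) m n :
  Rabs (sum_n_m f m n) <= sum_n_m (fun k => Rabs (f k)) m n.
Proof. exact (norm_sum_n_m (V := R_NormedModule) f m n). Qed.

Lemma sumR_Chasles (f : nat -> R) m n k : (m <= S n)%nat -> (n <= k)%nat ->
  sum_n_m f m k = sum_n_m f m n + sum_n_m f (S n) k.
Proof. exact (sum_n_m_Chasles f m n k). Qed.

Lemma sumR_subset (f : nat -> R) m n m' n' :
  (forall k, 0 <= f k) -> (m' <= m)%nat -> (n <= n')%nat ->
  sum_n_m f m n <= sum_n_m f m' n'.
Proof.
intros H H1 H2.
destruct (Nat.le_gt_cases m n) as [Hmn|Hmn].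
2: rewrite sumR_empty; auto; apply sumR_ge0; auto.
rewrite (sumR_Chasles f m' n n') by lia.
assert (0 <= sum_n_m f (S n) n') by (apply sumR_ge0; auto).
destruct m as [|m].
- replace m' with 0%nat by lia; lra.
- rewrite (sumR_Chasles f m' m n) by lia.
  assert (0 <= sum_n_m f m' m) by (apply sumR_ge0; auto). lra.
Qed.

Lemma sumR_shift_le (f : nat -> R) j m n :
  (forall k, 0 <= f k) -> (j <= m)%nat ->
  sum_n_m (fun k => f (k - j)%nat) m n <= sum_n_m f 0 (n - j).
Proof.
intros H Hj; sum_induction m n.
- apply sumR_ge0; auto.
- destruct (Nat.eq_dec m (S n)) as [->|Hne].
  + rewrite (sumR_empty _ (S n) n), Rplus_0_l by lia.
    apply Rle_trans with (sum_n_m f (S n - j) (S n - j)).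
    * rewrite sumR_one; lra.
    * apply sumR_subset; auto; lia.
  + replace (S n - j)%nat with (S (n - j)) by lia.
    rewrite (sumR_S f 0) by lia.
    now apply Rplus_le_compat_r.
- apply Rle_refl.
Qed.

Lemma sumR_step2_le (f : nat -> R) n N :
  (forall k, 0 <= f k) ->
  sum_n_m (fun i => f (n + 2 * i)%nat) 0 N <= sum_n_m f n (n + 2 * N).
Proof.
intros H; induction N as [|N IH].
- replace (n + 2 * 0)%nat with n by lia.
  rewrite 2!sumR_one; replace (n + 2 * 0)%nat with n by lia; lra.
- rewrite (sumR_S (fun i => f (n + 2 * i)%nat)) by lia.
  replace (n + 2 * S N)%nat with (S (S (n + 2 * N))) by lia.
  rewrite 2!sumR_S by lia.
  assert (0 <= f (S (n + 2 * N))) by auto. lra.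
Qed.

Lemma sumR_swap (f : nat -> nat -> R) m n m' n' :
  sum_n_m (fun i => sum_n_m (f i) m' n') m n =
  sum_n_m (fun j => sum_n_m (fun i => f i j) m n) m' n'.
Proof.
sum_induction m n.
- rewrite (sum_n_m_ext_loc _ (fun _ => 0) m' n')
    by (intros; apply sumR_empty; auto).
  now rewrite sum_n_m_const, Rmult_0_r.
- rewrite IH, <- sumR_plus; apply sum_n_m_ext_loc; intros.
  now rewrite sumR_S.
- apply sum_n_m_ext_loc; intros; now rewrite sumR_one.
Qed.

(** * Continuity and integration of finite sums *)

Lemma continuous_sumR (f : nat -> R -> R) m n :
  (forall k x, continuous (f k) x) ->
  forall x, continuous (fun y => sum_n_m (fun k => f k y) m n) x.
Proof.
intros H x; sum_induction m n.
- apply continuous_ext with (fun _ => 0); [|apply continuous_const].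
  intros; now rewrite sumR_empty.
- apply continuous_ext with (fun y => sum_n_m (fun k => f k y) m n + f (S n) y).
  + intros; now rewrite sumR_S.
  + now apply (continuous_plus (V := R_NormedModule)).
- apply continuous_ext with (f 0%nat); auto.
  intros; now rewrite sumR_one.
Qed.

Lemma ex_RInt_cont (f : R -> R) a b :
  (forall x, continuous f x) -> ex_RInt f a b.
Proof.
intros H; apply (ex_RInt_continuous (V := R_CompleteNormedModule)); auto.
Qed.

Lemma is_RInt_sumR (f : nat -> R -> R) (l : nat -> R) a b m n :
  (forall k, (m <= k <= n)%nat -> is_RInt (f k) a b (l k)) ->
  is_RInt (fun x => sum_n_m (fun k => f k x) m n) a b (sum_n_m l m n).
Proof.
sum_induction m n; intros H.
- apply is_RInt_ext with (fun _ => 0).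
  + intros; now rewrite sumR_empty.
  + evar_last; [apply (is_RInt_const (V := R_NormedModule) a b 0)|].
    apply Rmult_0_r.
- apply is_RInt_ext with (fun y => sum_n_m (fun k => f k y) m n + f (S n) y).
  + intros; now rewrite sumR_S.
  + apply (is_RInt_plus (V := R_NormedModule)); [apply IH; intros|]; apply H; lia.
- apply is_RInt_ext with (f 0%nat); [|now apply H].
  intros; now rewrite sumR_one.
Qed.

Lemma is_RInt_cont (f : R -> R) a b :
  (forall x, continuous f x) -> is_RInt f a b (RInt f a b).
Proof.
intros H; apply (RInt_correct (V := R_CompleteNormedModule)).
now apply ex_RInt_cont.
Qed.

Lemma is_RInt_scalR (c : R) (f : R -> R) a b l :
  is_RInt f a b l -> is_RInt (fun x => c * f x) a b (c * l).
Proof. exact (is_RInt_scal (V := R_NormedModule) f a b c l). Qed.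

Lemma is_RInt_plusR (f g : R -> R) a b l k :
  is_RInt f a b l -> is_RInt g a b k -> is_RInt (fun x => f x + g x) a b (l + k).
Proof. exact (is_RInt_plus (V := R_NormedModule) f g a b l k). Qed.

(** * The kernels sin(jx) / sin x *)

(** The quotient [sin(jx) / sin x], that is the Chebyshev polynomial
    [U_(j-1)(cos x)]; the recursion extends it continuously to the zeros of
    [sin]. *)
Fixpoint U (j : nat) (x : R) : R :=
  match j with
  | O => 0
  | S i => cos x * U i x + cos (INR i * x)
  end.

Lemma sin_mul_U j x : sin x * U j x = sin (INR j * x).
Proof.
induction j as [|j IH].
- simpl; rewrite Rmult_0_l, sin_0; ring.
- cbn [U]; rewrite S_INR.
  replace ((INR j + 1) * x) with (INR j * x + x) by ring.
  rewrite sin_plus, <- IH; ring.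
Qed.

Lemma U_step2 j x : U (S (S j)) x - U j x = 2 * cos (INR (S j) * x).
Proof.
induction j as [|j IH].
- simpl; rewrite Rmult_0_l, cos_0, Rmult_1_l; ring.
- change (U (S (S (S j))) x) with (cos x * U (S (S j)) x + cos (INR (S (S j)) * x)).
  change (U (S j) x) with (cos x * U j x + cos (INR j * x)).
  replace (U (S (S j)) x) with (2 * cos (INR (S j) * x) + U j x) by lra.
  replace (INR j * x) with (INR (S j) * x - x) by (rewrite S_INR; ring).
  replace (INR (S (S j)) * x) with (INR (S j) * x + x) by (rewrite (S_INR (S j)); ring).
  rewrite cos_plus, cos_minus; ring.
Qed.

Lemma Rabs_cos_le1 x : Rabs (cos x) <= 1.
Proof. apply Rabs_le; destruct (COS_bound x); lra. Qed.

Lemma Rabs_sin_le1 x : Rabs (sin x) <= 1.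
Proof. apply Rabs_le; destruct (SIN_bound x); lra. Qed.

Lemma U_le j x : Rabs (U j x) <= INR j.
Proof.
induction j as [|j IH].
- simpl; rewrite Rabs_R0; lra.
- cbn [U]; rewrite S_INR.
  eapply Rle_trans; [apply Rabs_triang|].
  apply Rplus_le_compat; [|apply Rabs_cos_le1].
  rewrite Rabs_mult, <- (Rmult_1_l (INR j)).
  apply Rmult_le_compat; auto using Rabs_pos, Rabs_cos_le1.
Qed.

Lemma U_even j x : U j (- x) = U j x.
Proof.
induction j as [|j IH]; auto; cbn [U].
now rewrite IH, cos_neg, Ropp_mult_distr_r_reverse, cos_neg.
Qed.

Lemma continuous_cos_mul c x : continuous (fun y => cos (c * y)) x.
Proof.
apply continuous_cos_comp.
apply (continuous_mult (K := R_AbsRing)); [apply continuous_const|apply continuous_id].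
Qed.

Lemma continuous_U j x : continuous (U j) x.
Proof.
revert x; induction j as [|j IH]; intros x; cbn [U].
- apply continuous_const.
- apply (continuous_plus (V := R_NormedModule)); [|apply continuous_cos_mul].
  apply (continuous_mult (K := R_AbsRing)); [apply continuous_cos|apply IH].
Qed.

(** Both trivial bounds, [j] and [1 / |sin x|], at once: up to the factor 2 the
    right-hand side is their minimum, and it is easy to integrate. *)
Lemma U_le_inv j x s : 0 <= s <= Rabs (sin x) ->
  Rabs (U j x) <= 2 * INR j / (1 + INR j * s).
Proof.
intros Hs.
assert (Hj := pos_INR j).
assert (0 <= INR j * s) by (apply Rmult_le_pos; lra).
apply Rmult_le_reg_r with (1 + INR j * s); [lra|].
unfold Rdiv; rewrite Rmult_assoc, Rinv_l, Rmult_1_r by lra.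
assert (H1 : Rabs (U j x) * s <= 1).
{ apply Rle_trans with (Rabs (U j x) * Rabs (sin x)).
  - apply Rmult_le_compat_l; [apply Rabs_pos|lra].
  - rewrite <- Rabs_mult, Rmult_comm, sin_mul_U; apply Rabs_sin_le1. }
assert (H2 := U_le j x). nra.
Qed.

Lemma sin_ge_third x : 0 <= x <= PI / 2 -> x / 3 <= sin x.
Proof.
intros Hx.
assert (HP := PI_4).
destruct (sin_bound x 0) as [H _]; [lra|lra|].
apply Rle_trans with (2 := H).
unfold sin_approx, sin_term; simpl. nra.
Qed.

Lemma sin_lower x : 0 <= x <= PI ->
  x / 3 <= Rabs (sin x) \/ (PI - x) / 3 <= Rabs (sin x).
Proof.
intros Hx; rewrite Rabs_right by (apply Rle_ge, sin_ge_0; lra).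
destruct (Rle_dec x (PI / 2)).
- left; apply sin_ge_third; lra.
- right; rewrite <- sin_PI_x; apply sin_ge_third; lra.
Qed.

Lemma is_RInt_inv_affine (p a b : R) (q : R) :
  (forall x, Rmin a b <= x <= Rmax a b -> 0 < q + p * x) ->
  is_RInt (fun x => p / (q + p * x)) a b (ln (q + p * b) - ln (q + p * a)).
Proof.
intros H.
apply (is_RInt_derive (V := R_CompleteNormedModule) (fun x => ln (q + p * x))).
- intros x Hx; auto_derive; [now apply H|].
  field. specialize (H x Hx); lra.
- intros x Hx. apply (ex_derive_continuous (V := R_NormedModule)).
  auto_derive. specialize (H x Hx); lra.
Qed.

(** The bound of [U_le_inv] is integrated exactly: it is the derivative of a
    logarithm. *)
Lemma RInt_U_half j : RInt (fun x => Rabs (U j x)) 0 PI <= 12 * ln (1 + 2 * INR j).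
Proof.
assert (HP := PI_RGT_0). assert (HP4 := PI_4). assert (Hj := pos_INR j).
set (p := INR j / 3).
assert (Hp : 0 <= p) by (unfold p; lra).
assert (I1 : is_RInt (fun x => p / (1 + p * x)) 0 PI (ln (1 + p * PI) - ln (1 + p * 0))).
{ apply is_RInt_inv_affine; intros x; rewrite Rmin_left, Rmax_right by lra; intros.
  assert (0 <= p * x) by (apply Rmult_le_pos; lra); lra. }
assert (I2 : is_RInt (fun x => (-p) / ((1 + p * PI) + (-p) * x)) 0 PI
   (ln ((1 + p * PI) + (-p) * PI) - ln ((1 + p * PI) + (-p) * 0))).
{ apply is_RInt_inv_affine; intros x; rewrite Rmin_left, Rmax_right by lra; intros.
  assert (0 <= p * (PI - x)) by (apply Rmult_le_pos; lra); lra. }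
assert (I3 : is_RInt (fun x => 6 * (p / (1 + p * x)) + (-6) * ((-p) / ((1 + p * PI) + (-p) * x)))
   0 PI (12 * ln (1 + p * PI))).
{ evar_last.
  - apply is_RInt_plusR; apply is_RInt_scalR; [exact I1|exact I2].
  - simpl; replace (1 + p * 0) with 1 by ring.
    replace (1 + p * PI + - p * PI) with 1 by ring.
    replace (1 + p * PI + - p * 0) with (1 + p * PI) by ring.
    rewrite ln_1; ring. }
apply Rle_trans with (12 * ln (1 + p * PI)).
- rewrite <- (is_RInt_unique _ _ _ _ I3).
  apply RInt_le; [lra| |eexists; exact I3|].
  + apply ex_RInt_cont; intros; apply (continuous_comp (U j) Rabs);
      [apply continuous_U|apply continuous_Rabs].
  + intros x Hx.
    assert (0 <= p * x) by (apply Rmult_le_pos; lra).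
    assert (0 <= p * (PI - x)) by (apply Rmult_le_pos; lra).
    assert (0 <= p / (1 + p * x)) by (apply Rdiv_le_0_compat; lra).
    assert (0 <= p / (1 + p * (PI - x))) by (apply Rdiv_le_0_compat; lra).
    replace ((-6) * ((-p) / ((1 + p * PI) + (-p) * x)))
      with (6 * (p / (1 + p * (PI - x)))) by (field; lra).
    destruct (sin_lower x) as [Hs|Hs]; [lra| |].
    * apply Rle_trans with (2 * INR j / (1 + INR j * (x / 3))).
      -- apply U_le_inv; lra.
      -- replace (INR j * (x / 3)) with (p * x) by (unfold p; field).
         replace (2 * INR j / (1 + p * x)) with (6 * (p / (1 + p * x)))
           by (unfold p; field; unfold p in *; lra). lra.
    * apply Rle_trans with (2 * INR j / (1 + INR j * ((PI - x) / 3))).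
      -- apply U_le_inv; lra.
      -- replace (INR j * ((PI - x) / 3)) with (p * (PI - x)) by (unfold p; field).
         replace (2 * INR j / (1 + p * (PI - x))) with (6 * (p / (1 + p * (PI - x))))
           by (unfold p; field; unfold p in *; lra). lra.
- assert (p * PI <= 2 * INR j) by (unfold p; nra).
  assert (0 <= p * PI) by (apply Rmult_le_pos; lra).
  apply Rmult_le_compat_l; [lra|]. apply ln_le; lra.
Qed.

Lemma continuous_Rabs_comp (f : R -> R) :
  (forall x, continuous f x) -> forall x, continuous (fun y => Rabs (f y)) x.
Proof.
intros H x; apply (continuous_comp f Rabs); [apply H|apply continuous_Rabs].
Qed.

Definition kernel_bound (j : nat) : R := 24 * ln (1 + 2 * INR j).

Lemma RInt_U j : RInt (fun x => Rabs (U j x)) (- PI) PI <= kernel_bound j.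
Proof.
assert (HC : forall a b, ex_RInt (fun x => Rabs (U j x)) a b).
{ intros; apply ex_RInt_cont, continuous_Rabs_comp, continuous_U. }
assert (E : RInt (fun x => Rabs (U j x)) (- PI) 0 = RInt (fun x => Rabs (U j x)) 0 PI).
{ apply is_RInt_unique.
  assert (H := RInt_correct _ _ _ (HC (- - PI) (- 0))).
  apply is_RInt_comp_opp in H.
  rewrite Ropp_0, Ropp_involutive in H.
  apply (is_RInt_opp (V := R_NormedModule)) in H.
  evar_last.
  - eapply is_RInt_ext; [|exact H].
    intros x _; simpl; rewrite U_even; unfold opp; simpl; ring.
  - apply (opp_RInt_swap (V := R_CompleteNormedModule)), HC. }
rewrite <- (RInt_Chasles _ _ 0 _ (HC _ _) (HC _ _)), E.
unfold plus, kernel_bound; simpl.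
assert (H := RInt_U_half j). lra.
Qed.

(** * Cosine polynomials *)

Definition cos_poly (b : nat -> R) (n : nat) (x : R) : R :=
  sum_n_m (fun k => b k * cos (INR k * x)) 0 n.

Lemma continuous_cos_poly b n x : continuous (cos_poly b n) x.
Proof.
apply continuous_sumR; intros k y.
apply (continuous_mult (K := R_AbsRing)); [apply continuous_const|].
apply continuous_cos_mul.
Qed.

(** [2 cos kx] is [U (k+1) x - U (k-1) x], so the sum is rearranged with
    differences of step 2. *)
Lemma cos_poly_by_parts b n x : b 0%nat = 0 ->
  2 * cos_poly b n x =
  sum_n_m (fun k => (b k - b (k + 2)%nat) * U (S k) x) 0 n
  + b (n + 2)%nat * U (S n) x + b (n + 1)%nat * U n x.
Proof.
intros H0; unfold cos_poly; induction n as [|n IH].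
- rewrite !sumR_one, H0; simpl; ring.
- rewrite !(sumR_S _ 0 n) by lia.
  rewrite Rmult_plus_distr_l, IH.
  replace (2 * (b (S n) * cos (INR (S n) * x))) with (b (S n) * (U (S (S n)) x - U n x))
    by (rewrite U_step2; ring).
  replace (S n + 1)%nat with (n + 2)%nat by lia.
  replace (n + 1)%nat with (S n) by lia. ring.
Qed.

Lemma RInt_cos_poly_le b n : b 0%nat = 0 ->
  2 * RInt (fun x => Rabs (cos_poly b n x)) (- PI) PI <=
  sum_n_m (fun k => Rabs (b k - b (k + 2)%nat) * kernel_bound (S k)) 0 n
  + Rabs (b (n + 2)%nat) * kernel_bound (S n) + Rabs (b (n + 1)%nat) * kernel_bound n.
Proof.
intros H0. assert (HP := PI_RGT_0).
set (I j := RInt (fun x => Rabs (U j x)) (- PI) PI : R).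
assert (HI : forall c j, is_RInt (fun x => c * Rabs (U j x)) (- PI) PI (c * I j)).
{ intros c j; apply is_RInt_scalR, is_RInt_cont. intros x; apply continuous_Rabs_comp, continuous_U. }
assert (HS : is_RInt (fun x =>
    sum_n_m (fun k => Rabs (b k - b (k + 2)%nat) * Rabs (U (S k) x)) 0 n
    + Rabs (b (n + 2)%nat) * Rabs (U (S n) x) + Rabs (b (n + 1)%nat) * Rabs (U n x))
  (- PI) PI
  (sum_n_m (fun k => Rabs (b k - b (k + 2)%nat) * I (S k)) 0 n
    + Rabs (b (n + 2)%nat) * I (S n) + Rabs (b (n + 1)%nat) * I n)).
{ apply is_RInt_plusR; [|apply HI].
  apply is_RInt_plusR; [|apply HI].
  apply is_RInt_sumR; intros; apply HI. }
assert (HC : forall c, is_RInt (fun x => c * Rabs (cos_poly b n x)) (- PI) PI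
  (c * RInt (fun x => Rabs (cos_poly b n x)) (- PI) PI)).
{ intros c; apply is_RInt_scalR, is_RInt_cont; intros y.
  apply continuous_Rabs_comp, continuous_cos_poly. }
apply Rle_trans with (sum_n_m (fun k => Rabs (b k - b (k + 2)%nat) * I (S k)) 0 n
    + Rabs (b (n + 2)%nat) * I (S n) + Rabs (b (n + 1)%nat) * I n).
- apply (is_RInt_le _ _ (- PI) PI _ _ ltac:(lra) (HC 2) HS); intros x _.
  rewrite <- (Rabs_right 2) by lra.
  rewrite <- Rabs_mult, cos_poly_by_parts, <- !Rabs_mult; auto.
  eapply Rle_trans; [apply Rabs_triang|].
  apply Rplus_le_compat_r.
  eapply Rle_trans; [apply Rabs_triang|].
  apply Rplus_le_compat_r.
  eapply Rle_trans; [apply sumR_abs|].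
  apply sumR_le; intros; rewrite Rabs_mult; apply Rle_refl.
- apply Rplus_le_compat; [apply Rplus_le_compat; [apply sumR_le; intros|]|];
    apply Rmult_le_compat_l; try apply Rabs_pos; apply RInt_U.
Qed.

(** * Orthogonality *)

Lemma is_RInt_cos_Z (j : Z) : j <> 0%Z ->
  is_RInt (fun x => cos (IZR j * x)) (- PI) PI 0.
Proof.
intros Hj. assert (IZR j <> 0) by now apply not_0_IZR.
evar_last.
- apply (is_RInt_derive (V := R_CompleteNormedModule) (fun x => sin (IZR j * x) / IZR j)).
  + intros x _; auto_derive; auto; now field.
  + intros x _; apply continuous_cos_mul.
- unfold minus, plus, opp; simpl.
  rewrite <- Ropp_mult_distr_r, sin_neg, sin_eq_0_1 by eauto.
  field; auto.
Qed.

Lemma is_RInt_cos_cos k l : (1 <= l)%nat ->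
  is_RInt (fun x => cos (INR k * x) * cos (INR l * x)) (- PI) PI
    (if Nat.eq_dec k l then PI else 0).
Proof.
intros Hl.
set (kz := Z.of_nat k); set (lz := Z.of_nat l).
assert (J : is_RInt (fun x => cos (IZR (kz - lz) * x)) (- PI) PI
              (if Nat.eq_dec k l then 2 * PI else 0)).
{ destruct (Nat.eq_dec k l) as [->|Hkl].
  - apply is_RInt_ext with (fun _ => 1).
    + intros x _; unfold kz, lz; now rewrite Z.sub_diag, Rmult_0_l, cos_0.
    + evar_last; [apply (is_RInt_const (V := R_NormedModule) (- PI) PI 1)|].
      unfold scal; simpl; unfold mult; simpl; ring.
  - apply is_RInt_cos_Z; lia. }
assert (J' : is_RInt (fun x => cos (IZR (kz + lz) * x)) (- PI) PI 0)
  by (apply is_RInt_cos_Z; lia).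
assert (J2 := is_RInt_scalR (/ 2) _ _ _ _ (is_RInt_plusR _ _ _ _ _ _ J J')).
evar_last.
- eapply is_RInt_ext; [|exact J2].
  intros x _; simpl.
  rewrite minus_IZR, plus_IZR; unfold kz, lz; rewrite <- !INR_IZR_INZ.
  rewrite Rmult_minus_distr_r, Rmult_plus_distr_r, cos_minus, cos_plus; field.
- destruct (Nat.eq_dec k l); lra.
Qed.

Lemma sumR_delta (b : nat -> R) l n c :
  sum_n_m (fun k => b k * (if Nat.eq_dec k l then c else 0)) 0 n =
  (if le_dec l n then b l * c else 0) :> R.
Proof.
induction n as [|n IH].
- rewrite sumR_one.
  destruct (Nat.eq_dec 0 l), (le_dec l 0); try lia; subst; ring.
- rewrite sumR_S, IH by lia.
  destruct (Nat.eq_dec (S n) l), (le_dec l n), (le_dec l (S n)); try lia; subst; ring.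
Qed.

Lemma is_RInt_cos_poly_cos b n l : (1 <= l)%nat ->
  is_RInt (fun x => cos_poly b n x * cos (INR l * x)) (- PI) PI
    (if le_dec l n then b l * PI else 0).
Proof.
intros Hl; rewrite <- sumR_delta.
apply is_RInt_ext with
  (fun x => sum_n_m (fun k => b k * (cos (INR k * x) * cos (INR l * x))) 0 n).
- intros x _; unfold cos_poly; rewrite (Rmult_comm (sum_n_m _ _ _)), <- sumR_scal.
  apply sum_n_m_ext; intros k; apply Rminus_diag_uniq; ring.
- apply is_RInt_sumR; intros k _.
  now apply is_RInt_scalR, is_RInt_cos_cos.
Qed.

(** * A bounded test function *)

Definition sine_sum (N : nat) (x : R) : R :=
  sum_n_m (fun i => sin (INR (2 * i) * x) / INR i) 1 N.

Lemma sin_nat_le k x : Rabs (sin (INR k * x)) <= INR k * Rabs (sin x).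
Proof.
rewrite <- sin_mul_U, Rabs_mult, Rmult_comm.
apply Rmult_le_compat_r; [apply Rabs_pos|apply U_le].
Qed.

(** Efficient as long as [N] is at most of order [1 / |sin x|]. *)
Lemma sine_sum_head N x : Rabs (sine_sum N x) <= 2 * INR N * Rabs (sin x).
Proof.
unfold sine_sum. eapply Rle_trans; [apply sumR_abs|].
apply Rle_trans with (sum_n_m (fun _ => 2 * Rabs (sin x)) 1 N).
- apply sumR_le; intros i Hi.
  assert (0 < INR i) by (apply lt_0_INR; lia).
  unfold Rdiv; rewrite Rabs_mult, (Rabs_right (/ INR i))
    by (apply Rle_ge, Rlt_le, Rinv_0_lt_compat; auto).
  apply Rmult_le_reg_r with (INR i); auto.
  rewrite Rmult_assoc, Rinv_l, Rmult_1_r by lra.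
  apply Rle_trans with (1 := sin_nat_le _ _).
  rewrite mult_INR; simpl; right; ring.
- rewrite sum_n_m_const; replace (S N - 1)%nat with N by lia; right; ring.
Qed.

(** Summation by parts: [2 sin x sin(2ix)] telescopes and the weights [1/i]
    decrease. The boundary term is kept on the left to make the induction run. *)
Lemma sine_sum_tail M d x :
  let N := (M + 1 + d)%nat in
  Rabs (2 * sin x * (sine_sum N x - sine_sum M x)
        + cos (INR (2 * N + 1) * x) / INR N) <= 2 / INR (M + 1) - / INR N.
Proof.
assert (Hs : forall i, 2 * sin x * sin (INR (2 * i) * x) =
  cos (INR (2 * i) * x - x) - cos (INR (2 * i) * x + x)).
{ intros i; rewrite cos_minus, cos_plus; ring. }
cbv zeta; induction d as [|d IH].
- rewrite Nat.add_0_r.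
  assert (0 < INR (M + 1)) by (apply lt_0_INR; lia).
  unfold sine_sum; replace (M + 1)%nat with (S M) in * by lia.
  rewrite sumR_S by lia.
  match goal with |- Rabs ?e <= _ => replace e with
    (cos (INR (2 * S M) * x - x) / INR (S M)) end.
  + unfold Rdiv; rewrite Rabs_mult, (Rabs_right (/ INR (S M)))
      by (apply Rle_ge, Rlt_le, Rinv_0_lt_compat; auto).
    assert (0 < / INR (S M)) by now apply Rinv_0_lt_compat.
    assert (H1 := Rabs_cos_le1 (INR (2 * S M) * x - x)). nra.
  + replace (INR (2 * S M + 1) * x) with (INR (2 * S M) * x + x)
      by (rewrite (plus_INR _ 1); simpl; ring).
    specialize (Hs (S M)).
    match goal with |- _ = 2 * sin x * (?a + ?b / ?c - ?a) + _ =>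
      replace (2 * sin x * (a + b / c - a)) with ((2 * sin x * b) / c) by (field; lra) end.
    rewrite Hs; field; lra.
- set (N := (M + 1 + d)%nat) in *.
  replace (M + 1 + S d)%nat with (S N) by lia.
  assert (HN : 0 < INR N) by (apply lt_0_INR; lia).
  assert (HN1 : INR (S N) = INR N + 1) by apply S_INR.
  assert (Hd : 0 <= / INR N - / INR (S N)).
  { assert (/ INR (S N) <= / INR N) by (apply Rinv_le_contravar; lra). lra. }
  assert (E : sine_sum (S N) x = sine_sum N x + sin (INR (2 * S N) * x) / INR (S N)).
  { unfold sine_sum; now rewrite sumR_S by lia. }
  match type of IH with Rabs ?e <= _ =>
  match goal with |- Rabs ?e' <= _ =>
    replace e' with (e - cos (INR (2 * N + 1) * x) * (/ INR N - / INR (S N))) end end.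
  + eapply Rle_trans; [apply Rabs_triang|].
    rewrite Rabs_Ropp, Rabs_mult, (Rabs_right (_ - _)) by lra.
    assert (H1 := Rabs_cos_le1 (INR (2 * N + 1) * x)). nra.
  + rewrite E. specialize (Hs (S N)).
    replace (INR (2 * S N + 1) * x) with (INR (2 * S N) * x + x)
      by (rewrite (plus_INR _ 1); simpl; ring).
    replace (INR (2 * N + 1) * x) with (INR (2 * S N) * x - x)
      by (rewrite plus_INR, !mult_INR, HN1; simpl; ring).
    match goal with |- _ = 2 * sin x * (?a + ?b / ?c - ?m) + _ =>
      replace (2 * sin x * (a + b / c - m)) with (2 * sin x * (a - m) + (2 * sin x * b) / c)
        by (field; lra) end.
    rewrite Hs; field; lra.
Qed.

(** The sum is cut at [M], the integer part of [1 / |sin x|]. *)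
Lemma sine_sum_bounded N x : Rabs (sine_sum N x) <= 4.
Proof.
set (s := Rabs (sin x)).
destruct (Req_dec s 0) as [Hs|Hs].
{ apply Rle_trans with (1 := sine_sum_head N x); fold s; rewrite Hs; lra. }
assert (Hs0 : 0 < s) by (assert (0 <= s) by apply Rabs_pos; lra).
assert (Hi : 0 < / s) by now apply Rinv_0_lt_compat.
destruct (nfloor_ex (/ s)) as [M [HM1 HM2]]; [lra|].
assert (Hh : INR M * s <= 1).
{ apply Rmult_le_reg_r with (/ s); auto. rewrite Rmult_assoc, Rinv_r, Rmult_1_r by lra. lra. }
destruct (Nat.le_gt_cases N M) as [HNM|HNM].
{ apply Rle_trans with (1 := sine_sum_head N x); fold s.
  assert (INR N <= INR M) by now apply le_INR. nra. }
assert (Ht := sine_sum_tail M (N - M - 1) x).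
replace (M + 1 + (N - M - 1))%nat with N in Ht by lia. cbv zeta in Ht.
assert (HN : 0 < INR N) by (apply lt_0_INR; lia).
assert (HiN := Rinv_0_lt_compat _ HN).
set (D := sine_sum N x - sine_sum M x) in *.
set (e := cos (INR (2 * N + 1) * x) / INR N) in *.
assert (He : Rabs e <= / INR N).
{ unfold e, Rdiv; rewrite Rabs_mult, (Rabs_right (/ INR N)) by lra.
  assert (H1 := Rabs_cos_le1 (INR (2 * N + 1) * x)). nra. }
assert (HD : 2 * s * Rabs D <= 2 / INR (M + 1)).
{ replace (2 * s * Rabs D) with (Rabs (2 * sin x * D + e - e)).
  - eapply Rle_trans; [apply Rabs_triang|]. rewrite Rabs_Ropp; lra.
  - replace (2 * sin x * D + e - e) with (2 * sin x * D) by ring.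
    rewrite !Rabs_mult, (Rabs_right 2) by lra; reflexivity. }
assert (HMs : 1 <= INR (M + 1) * s).
{ apply Rmult_le_reg_r with (/ s); auto. rewrite Rmult_assoc, Rinv_r, Rmult_1_r by lra.
  rewrite plus_INR; simpl; lra. }
assert (HM : 0 < INR (M + 1)) by (apply lt_0_INR; lia).
assert (HD1 : Rabs D <= 1).
{ apply Rmult_le_reg_l with (2 * s); [lra|]. apply Rle_trans with (1 := HD).
  apply Rmult_le_reg_r with (INR (M + 1)); auto.
  unfold Rdiv; rewrite Rmult_assoc, Rinv_l by lra. lra. }
assert (H2 := sine_sum_head M x). fold s in H2.
replace (sine_sum N x) with (sine_sum M x + D) by (unfold D; ring).
eapply Rle_trans; [apply Rabs_triang|]. lra.
Qed.

(** Testing against [2 sin(nx) sine_sum N x], whose Fourier coefficients are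
    [1/i] at the frequencies [n - 2i] and [-1/i] at the frequencies [n + 2i],
    the latter being outside the spectrum. *)
Lemma cos_poly_test b n N : (2 * N < n)%nat ->
  Rabs (sum_n_m (fun i => b (n - 2 * i)%nat / INR i) 1 N) <=
  3 * RInt (fun x => Rabs (cos_poly b n x)) (- PI) PI.
Proof.
intros HN.
set (g x := cos_poly b n x * (2 * sin (INR n * x) * sine_sum N x)).
assert (HP := PI2_3_2).
assert (Hg : is_RInt g (- PI) PI
  (PI * sum_n_m (fun i => b (n - 2 * i)%nat / INR i) 1 N)).
{ rewrite <- sumR_scal.
  apply is_RInt_ext with (fun x => sum_n_m (fun i => / INR i *
    (cos_poly b n x * cos (INR (n - 2 * i) * x)
     + -1 * (cos_poly b n x * cos (INR (n + 2 * i) * x)))) 1 N).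
  - intros x _; unfold g, sine_sum.
    rewrite <- !sumR_scal; apply sum_n_m_ext_loc; intros i Hi.
    assert (0 < INR i) by (apply lt_0_INR; lia).
    rewrite minus_INR, plus_INR by lia.
    rewrite Rmult_minus_distr_r, Rmult_plus_distr_r, cos_minus, cos_plus.
    apply Rminus_diag_uniq; field; lra.
  - apply is_RInt_sumR; intros i Hi.
    assert (0 < INR i) by (apply lt_0_INR; lia).
    assert (H1 := is_RInt_cos_poly_cos b n (n - 2 * i) ltac:(lia)).
    assert (H2 := is_RInt_cos_poly_cos b n (n + 2 * i) ltac:(lia)).
    destruct (le_dec (n - 2 * i) n) as [_|]; [|lia].
    destruct (le_dec (n + 2 * i) n) as [|_]; [lia|].
    evar_last.
    + apply is_RInt_scalR, is_RInt_plusR; [exact H1|apply is_RInt_scalR, H2].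
    + simpl; field; lra. }
assert (HC : forall c, is_RInt (fun x => c * Rabs (cos_poly b n x)) (- PI) PI
  (c * RInt (fun x => Rabs (cos_poly b n x)) (- PI) PI)).
{ intros c; apply is_RInt_scalR, is_RInt_cont; intros y.
  apply continuous_Rabs_comp, continuous_cos_poly. }
set (S := sum_n_m _ 1 N) in *.
set (J := RInt _ _ _).
assert (HS : PI * Rabs S <= 8 * J).
{ rewrite <- (Rabs_right PI) at 1 by lra.
  rewrite <- Rabs_mult, <- (is_RInt_unique _ _ _ _ Hg).
  eapply Rle_trans; [apply abs_RInt_le; [lra|eexists; exact Hg]|].
  destruct (ex_RInt_norm g (- PI) PI (ex_intro _ _ Hg)) as [l Hl].
  change (is_RInt (fun x => Rabs (g x)) (- PI) PI l) in Hl.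
  rewrite (is_RInt_unique _ _ _ _ Hl).
  apply (is_RInt_le _ _ (- PI) PI _ _ ltac:(lra) Hl (HC 8)); intros x _.
  change (Rabs (g x) <= 8 * Rabs (cos_poly b n x)); unfold g.
  rewrite !Rabs_mult, (Rabs_right 2), (Rmult_comm 8) by lra.
  apply Rmult_le_compat_l; [apply Rabs_pos|].
  assert (H1 := Rabs_sin_le1 (INR n * x)).
  assert (H2 := sine_sum_bounded N x).
  assert (H3 := Rabs_pos (sin (INR n * x))).
  assert (H4 := Rabs_pos (sine_sum N x)). nra. }
assert (0 <= Rabs S) by apply Rabs_pos. nra.
Qed.

(** * Limits and block sums *)

Lemma is_lim_seq_0 (u : nat -> R) :
  is_lim_seq u 0 <->
  (forall eps, 0 < eps -> exists N, forall n, (N <= n)%nat -> Rabs (u n) <= eps).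
Proof.
split; intros H.
- intros eps He.
  apply is_lim_seq_spec in H.
  destruct (H (mkposreal eps He)) as [N HN]; exists N; intros n Hn.
  specialize (HN n Hn); simpl in HN; rewrite Rminus_0_r in HN; lra.
- apply is_lim_seq_spec; intros [eps He].
  destruct (H (eps / 2)) as [N HN]; [lra|]; exists N; intros n Hn.
  specialize (HN n Hn); simpl; rewrite Rminus_0_r; lra.
Qed.

Lemma is_lim_seq_0_le (u v : nat -> R) N :
  (forall n, (N <= n)%nat -> Rabs (u n) <= v n) -> is_lim_seq v 0 -> is_lim_seq u 0.
Proof.
intros H Hv; apply is_lim_seq_0; intros eps He.
destruct (proj1 (is_lim_seq_0 v) Hv eps He) as [N' HN'].
exists (N + N')%nat; intros n Hn.
apply Rle_trans with (1 := H n ltac:(lia)).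
apply Rle_trans with (1 := Rle_abs _), HN'; lia.
Qed.

Lemma is_lim_seq_0_lin (u v : nat -> R) c d :
  is_lim_seq u 0 -> is_lim_seq v 0 -> is_lim_seq (fun n => c * u n + d * v n) 0.
Proof.
intros Hu Hv.
replace (Finite 0) with (Finite (c * 0 + d * 0)) by (f_equal; ring).
apply is_lim_seq_plus'; now apply (is_lim_seq_scal_l _ _ (Finite 0)).
Qed.

Lemma ln_ge0 x : 1 <= x -> 0 <= ln x.
Proof. intros H; rewrite <- ln_1; apply ln_le; lra. Qed.

Lemma INR_ge1 n : (1 <= n)%nat -> 1 <= INR n.
Proof. exact (le_INR 1 n). Qed.

(** A sum over [0, n] is dominated by the blocks [m, 2m) with [m] about [n/2],
    [n/4], ..., whose bounds [eps m] form a geometric series. *)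
Lemma dyadic_sum (x : nat -> R) :
  (forall k, 0 <= x k) ->
  is_lim_seq (fun m => sum_n_m x m (2 * m - 1) / INR m) 0 ->
  is_lim_seq (fun n => sum_n_m x 0 n / (INR n + 1)) 0.
Proof.
intros Hx H; apply is_lim_seq_0; intros eps He.
destruct (proj1 (is_lim_seq_0 _) H (eps / 5) ltac:(lra)) as [M HM].
set (K := sum_n_m x 0 (2 * M + 2)).
assert (HK : 0 <= K) by (apply sumR_ge0; auto).
assert (Hs : forall n, sum_n_m x 0 n <= K + 4 * (eps / 5) * (INR n + 1)).
{ induction n as [n IH] using lt_wf_ind.
  assert (Hn0 := pos_INR n).
  destruct (Nat.le_gt_cases n (2 * M + 2)) as [Hn|Hn].
  { assert (sum_n_m x 0 n <= K) by (apply sumR_subset; auto).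
    assert (0 <= 4 * (eps / 5) * (INR n + 1)) by (apply Rmult_le_pos; lra). lra. }
  set (m := ((n + 2) / 2)%nat).
  assert (Hm : (2 * m <= n + 2 /\ n <= 2 * m - 1)%nat).
  { assert (E := Nat.div_mod_eq (n + 2) 2).
    assert (L := Nat.mod_upper_bound (n + 2) 2). unfold m; lia. }
  assert (Hm1 : 1 <= INR m) by (apply INR_ge1; lia).
  assert (Hmn : 2 * INR m <= INR n + 2).
  { change 2 with (INR 2) at 1 2; rewrite <- mult_INR, <- plus_INR; apply le_INR; lia. }
  assert (Hn2 : 2 <= INR n) by (apply (le_INR 2); lia).
  assert (H1 : sum_n_m x 0 n <= sum_n_m x 0 (2 * m - 1)) by (apply sumR_subset; auto; lia).
  rewrite (sumR_Chasles x 0 (m - 1) (2 * m - 1)) in H1 by lia.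
  replace (S (m - 1)) with m in H1 by lia.
  specialize (IH (m - 1)%nat ltac:(lia)).
  rewrite minus_INR in IH by lia; simpl (INR 1) in IH.
  assert (H2 : sum_n_m x m (2 * m - 1) <= eps / 5 * INR m).
  { apply Rmult_le_reg_r with (/ INR m); [apply Rinv_0_lt_compat; lra|].
    rewrite Rmult_assoc, Rinv_r, Rmult_1_r by lra.
    apply Rle_trans with (1 := Rle_abs _), HM; lia. }
  assert (eps * (2 * INR m) <= eps * (INR n + 2)) by (apply Rmult_le_compat_l; lra).
  assert (eps * 2 <= eps * INR n) by (apply Rmult_le_compat_l; lra).
  lra. }
destruct (nfloor_ex (K / (eps / 5))) as [N [_ HN]].
{ apply Rdiv_le_0_compat; lra. }
exists N; intros n Hn.
assert (Hn0 : INR N <= INR n) by now apply le_INR.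
assert (HN0 := pos_INR N).
assert (HKn : K <= eps / 5 * (INR n + 1)).
{ apply Rmult_le_reg_r with (/ (eps / 5)); [apply Rinv_0_lt_compat; lra|].
  unfold Rdiv in HN. replace (eps / 5 * (INR n + 1) * / (eps / 5)) with (INR n + 1) by (field; lra).
  unfold Rdiv; lra. }
rewrite Rabs_right.
- apply Rmult_le_reg_r with (INR n + 1); [lra|].
  unfold Rdiv; rewrite Rmult_assoc, Rinv_l by lra.
  specialize (Hs n). lra.
- apply Rle_ge, Rdiv_le_0_compat; [apply sumR_ge0; auto|lra].
Qed.

(** For [u k = |a_k|] these are the quantities whose supremum over
    [m >= [n/c]] is [ln n] times [beta6 c a n]. *)
Definition log_mean (u : nat -> R) (m : nat) : R :=
  ln (INR m) / INR m * sum_n_m u m (2 * m).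

Lemma log_mean_ge0 u m : (forall k, 0 <= u k) -> 0 <= log_mean u m.
Proof.
intros Hu. destruct m as [|m].
- unfold log_mean; rewrite sumR_one; simpl. unfold Rdiv.
  rewrite Rinv_0, Rmult_0_r, Rmult_0_l; lra.
- assert (1 <= INR (S m)) by (apply INR_ge1; lia).
  apply Rmult_le_pos; [|apply sumR_ge0; auto].
  apply Rdiv_le_0_compat; [now apply ln_ge0|lra].
Qed.

Lemma log_mean_le u v m : (1 <= m)%nat -> (forall k, u k <= v k) ->
  log_mean u m <= log_mean v m.
Proof.
intros Hm H. assert (1 <= INR m) by now apply INR_ge1.
apply Rmult_le_compat_l; [|now apply sumR_le].
apply Rdiv_le_0_compat; [now apply ln_ge0|lra].
Qed.

(** On [m, 2m] the factor [ln m] is at most [ln k]. *)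
Lemma log_mean_lim (u : nat -> R) : (forall k, 0 <= u k) ->
  is_lim_seq (fun n => u n * ln (INR n)) 0 -> is_lim_seq (log_mean u) 0.
Proof.
intros Hu H; apply is_lim_seq_0; intros eps He.
destruct (proj1 (is_lim_seq_0 _) H (eps / 2) ltac:(lra)) as [N HN].
exists (S N); intros m Hm.
rewrite Rabs_right by now apply Rle_ge, log_mean_ge0.
assert (Hm1 : 1 <= INR m) by (apply INR_ge1; lia).
unfold log_mean.
apply Rle_trans with (/ INR m * sum_n_m (fun _ => eps / 2) m (2 * m)).
- replace (ln (INR m) / INR m * sum_n_m u m (2 * m))
    with (/ INR m * (ln (INR m) * sum_n_m u m (2 * m))) by (field; lra).
  apply Rmult_le_compat_l; [apply Rlt_le, Rinv_0_lt_compat; lra|].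
  rewrite <- sumR_scal; apply sumR_le; intros k Hk.
  apply Rle_trans with (u k * ln (INR k)).
  + rewrite Rmult_comm; apply Rmult_le_compat_l; auto.
    apply ln_le; [lra|apply le_INR; lia].
  + apply Rle_trans with (1 := Rle_abs _), HN; lia.
- rewrite sum_n_m_const; replace (S (2 * m) - m)%nat with (S m) by lia.
  rewrite S_INR. apply Rmult_le_reg_l with (INR m); [lra|].
  rewrite <- Rmult_assoc, Rinv_r by lra. nra.
Qed.

(** * From small coefficients to small norms *)

(** [k p_k - (k+2) p_(k+2)] is [(k+2)(p_k - p_(k+2)) - 2 p_k], and [k + 2] is
    at most [3m] on the block. *)
Lemma block_var_le (p : nat -> R) m : (1 <= m)%nat ->
  let b k := INR k * p k in
  ln (INR m) * sum_n_m (fun k => Rabs (b k - b (k + 2)%nat)) m (2 * m - 1) <=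
  INR m * (3 * (ln (INR m) * sum_n_m (fun k => Rabs (p k - p (k + 2)%nat)) m (2 * m - 1))
           + 2 * log_mean (fun k => Rabs (p k)) m).
Proof.
intros Hm b.
assert (Hm1 : 1 <= INR m) by now apply INR_ge1.
assert (Hl := ln_ge0 _ Hm1).
set (T := sum_n_m (fun k => Rabs (p k - p (k + 2)%nat)) m (2 * m - 1)).
assert (HS : sum_n_m (fun k => Rabs (b k - b (k + 2)%nat)) m (2 * m - 1) <=
  3 * INR m * T + 2 * sum_n_m (fun k => Rabs (p k)) m (2 * m)).
{ apply Rle_trans with (sum_n_m (fun k => 3 * INR m * Rabs (p k - p (k + 2)%nat)
    + 2 * Rabs (p k)) m (2 * m - 1)).
  - apply sumR_le; intros k Hk; unfold b.
    replace (INR k * p k - INR (k + 2) * p (k + 2)%nat)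
      with (INR (k + 2) * (p k - p (k + 2)%nat) + - (2 * p k))
      by (rewrite plus_INR; simpl; ring).
    eapply Rle_trans; [apply Rabs_triang|].
    rewrite Rabs_Ropp, !Rabs_mult, (Rabs_right 2) by lra.
    apply Rplus_le_compat_r, Rmult_le_compat_r; [apply Rabs_pos|].
    rewrite Rabs_right by apply Rle_ge, pos_INR.
    replace (3 * INR m) with (INR (3 * m)) by (rewrite mult_INR; simpl; ring).
    apply le_INR; lia.
  - rewrite sumR_plus, !sumR_scal; apply Rplus_le_compat_l, Rmult_le_compat_l; [lra|].
    apply sumR_subset; try lia; intros; apply Rabs_pos. }
apply Rle_trans with (1 := Rmult_le_compat_l _ _ _ Hl HS).
unfold log_mean; right; field; lra.
Qed.

Lemma ln_le_pow (k : nat) x y : 0 < x -> 0 < y -> x <= y ^ k -> ln x <= INR k * ln y.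
Proof.
intros Hx Hy H; rewrite <- ln_pow by auto; now apply ln_le.
Qed.

(** The kernels cost a factor [ln k], which the hypotheses on [p] compensate
    block by block; what is left is summed by [dyadic_sum]. *)
Lemma cos_poly_lim_of_log (p : nat -> R) :
  is_lim_seq (fun m => ln (INR m) *
    sum_n_m (fun k => Rabs (p k - p (k + 2)%nat)) m (2 * m - 1)) 0 ->
  is_lim_seq (fun n => Rabs (p n) * ln (INR n)) 0 ->
  is_lim_seq (fun n => / (INR n + 1) *
    RInt (fun x => Rabs (cos_poly (fun k => INR k * p k) n x)) (- PI) PI) 0.
Proof.
intros HT Hp.
set (b k := INR k * p k).
set (y k := Rabs (b k - b (k + 2)%nat) * kernel_bound (S k)).
assert (Hkb : forall j, 0 <= kernel_bound j).
{ intros j; apply Rmult_le_pos; [lra|apply ln_ge0]. assert (H := pos_INR j); lra. }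
assert (Hy : is_lim_seq (fun n => sum_n_m y 0 n / (INR n + 1)) 0).
{ apply dyadic_sum.
  - intros k; apply Rmult_le_pos; auto using Rabs_pos.
  - assert (HB := log_mean_lim _ (fun k => Rabs_pos (p k)) Hp).
    (* 72 = 24 * 3, since 1 + 4m <= m^3 gives the kernels of the block the bound
       24 * 3 ln m; then 216 = 72 * 3 and 144 = 72 * 2 by [block_var_le]. *)
    apply (is_lim_seq_0_le _ _ 3) with (2 := is_lim_seq_0_lin _ _ 216 144 HT HB).
    intros m Hm.
    assert (Hm3 : 3 <= INR m) by (replace 3 with (INR 3) by (simpl; ring); now apply le_INR).
    assert (Hl : 0 <= ln (INR m)) by (apply ln_ge0; lra).
    assert (Hv := block_var_le p m ltac:(lia)); cbv zeta in Hv; fold b in Hv.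
    set (X := sum_n_m (fun k => Rabs (b k - b (k + 2)%nat)) m (2 * m - 1)) in *.
    assert (HyX : sum_n_m y m (2 * m - 1) <= 72 * ln (INR m) * X).
    { unfold X; rewrite <- sumR_scal; apply sumR_le; intros k Hk; unfold y.
      rewrite Rmult_comm; apply Rmult_le_compat_r; [apply Rabs_pos|].
      unfold kernel_bound.
      assert (Hk2 : INR (S k) <= 2 * INR m).
      { change 2 with (INR 2); rewrite <- mult_INR; apply le_INR; lia. }
      assert (HS := pos_INR (S k)).
      assert (ln (1 + 2 * INR (S k)) <= INR 3 * ln (INR m)).
      { apply ln_le_pow; try lra. apply Rle_trans with (1 + 4 * INR m); [lra|].
        simpl. assert (9 <= INR m * INR m) by nra. nra. }
      simpl INR in *; lra. }
    rewrite Rabs_right.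
    + apply Rmult_le_reg_r with (INR m); [lra|].
      unfold Rdiv; rewrite Rmult_assoc, Rinv_l, Rmult_1_r by lra.
      apply Rle_trans with (1 := HyX). lra.
    + apply Rle_ge, Rdiv_le_0_compat; [|lra].
      apply sumR_ge0; intros; apply Rmult_le_pos; auto using Rabs_pos. }
assert (Hp1 := proj1 (is_lim_seq_incr_n _ 1 _) Hp).
assert (Hp2 := proj1 (is_lim_seq_incr_n _ 2 _) Hp).
assert (Hq := is_lim_seq_0_lin _ _ 1 1 (is_lim_seq_0_lin _ _ 48 24 Hp2 Hp1)
  (is_lim_seq_0_lin _ _ (/ 2) 0 Hy Hy)).
apply (is_lim_seq_0_le _ _ 1) with (2 := Hq); intros n Hn.
assert (Hn1 : 1 <= INR n) by now apply INR_ge1.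
set (J := RInt _ _ _).
assert (HJ : 2 * J <= sum_n_m y 0 n
  + Rabs (b (n + 2)%nat) * kernel_bound (S n) + Rabs (b (n + 1)%nat) * kernel_bound n).
{ apply RInt_cos_poly_le; unfold b; simpl; ring. }
assert (HJ0 : 0 <= J).
{ apply RInt_ge_0.
  - assert (H := PI_RGT_0); lra.
  - apply ex_RInt_cont; intros x; apply continuous_Rabs_comp, continuous_cos_poly.
  - intros; apply Rabs_pos. }
rewrite Rabs_right.
2:{ apply Rle_ge, Rmult_le_pos; auto. apply Rlt_le, Rinv_0_lt_compat; lra. }
apply Rmult_le_reg_l with (2 * (INR n + 1)); [lra|].
rewrite Rmult_assoc, <- (Rmult_assoc (INR n + 1)), Rinv_r, Rmult_1_l by lra.
apply Rle_trans with (1 := HJ).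
assert (H2 : Rabs (b (n + 2)%nat) * kernel_bound (S n) <=
  96 * (INR n + 1) * (Rabs (p (n + 2)%nat) * ln (INR (n + 2)))).
{ unfold b, kernel_bound; rewrite Rabs_mult, (Rabs_right (INR (n + 2))) by apply Rle_ge, pos_INR.
  rewrite S_INR, plus_INR; simpl (INR 2).
  assert (L : ln (1 + 2 * (INR n + 1)) <= INR 2 * ln (INR n + (1 + 1)))
    by (apply ln_le_pow; simpl; nra).
  simpl in L. set (l := ln (INR n + (1 + 1))) in *. set (q := Rabs (p (n + 2)%nat)).
  assert (0 <= q) by apply Rabs_pos.
  assert (0 <= l) by (apply ln_ge0; lra).
  assert (0 <= (INR n + 2) * q) by (apply Rmult_le_pos; lra).
  assert (0 <= q * l) by (apply Rmult_le_pos; lra).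
  apply Rle_trans with ((INR n + 2) * q * (48 * l)).
  - replace (1 + 1) with 2 by ring. apply Rmult_le_compat_l; lra.
  - nra. }
assert (H1 : Rabs (b (n + 1)%nat) * kernel_bound n <=
  48 * (INR n + 1) * (Rabs (p (n + 1)%nat) * ln (INR (n + 1)))).
{ unfold b, kernel_bound; rewrite Rabs_mult, (Rabs_right (INR (n + 1))) by apply Rle_ge, pos_INR.
  rewrite plus_INR; simpl (INR 1).
  assert (L : ln (1 + 2 * INR n) <= INR 2 * ln (INR n + 1))
    by (apply ln_le_pow; simpl; nra).
  simpl in L. set (l := ln (INR n + 1)) in *. set (q := Rabs (p (n + 1)%nat)).
  assert (0 <= q) by apply Rabs_pos.
  assert (0 <= (INR n + 1) * q) by (apply Rmult_le_pos; lra).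
  replace (48 * (INR n + 1) * (q * l)) with ((INR n + 1) * q * (48 * l)) by ring.
  apply Rmult_le_compat_l; lra. }
set (A2 := Rabs (p (n + 2)%nat) * ln (INR (n + 2))) in *.
set (A1 := Rabs (p (n + 1)%nat) * ln (INR (n + 1))) in *.
apply Rle_trans with (sum_n_m y 0 n + 96 * (INR n + 1) * A2 + 48 * (INR n + 1) * A1); [lra|].
right; field; lra.
Qed.

(** * From small norms to small means *)

Lemma harmonic_ge_ln N : ln (INR N + 1) <= sum_n_m (fun i => / INR i) 1 N.
Proof.
induction N as [|N IH].
- rewrite sumR_empty by lia; simpl; rewrite Rplus_0_l, ln_1; lra.
- rewrite sumR_S by lia.
  assert (HN := pos_INR N); rewrite S_INR.
  assert (H : ln (INR N + 1 + 1) <= ln (INR N + 1) + / (INR N + 1)).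
  { replace (INR N + 1 + 1) with ((INR N + 1) * (1 + / (INR N + 1))) by (field; lra).
    assert (0 < / (INR N + 1)) by (apply Rinv_0_lt_compat; lra).
    rewrite ln_mult by lra. apply Rplus_le_compat_l.
    rewrite <- (ln_exp (/ (INR N + 1))) at 2.
    apply ln_le; [lra|]. apply Rlt_le, exp_ineq1; lra. }
  lra.
Qed.

(** [b n - b (n - 2i)] is a sum of [i] steps of length 2, and the [j]-th steps
    belonging to different [n] are different. *)
Lemma sum_shift_diff_le (b : nat -> R) m i : (2 * i <= m)%nat ->
  sum_n_m (fun n => Rabs (b n - b (n - 2 * i)%nat)) m (2 * m) <=
  INR i * sum_n_m (fun k => Rabs (b k - b (k + 2)%nat)) 0 (2 * m).
Proof.
set (x k := Rabs (b k - b (k + 2)%nat)).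
assert (Hx : forall k, 0 <= x k) by (intros; apply Rabs_pos).
induction i as [|i IH]; intros Hi.
- simpl INR; rewrite Rmult_0_l.
  apply Rle_trans with (sum_n_m (fun _ => 0) m (2 * m)).
  + apply sumR_le; intros n _.
    replace (n - 2 * 0)%nat with n by lia.
    rewrite Rminus_diag, Rabs_R0; lra.
  + rewrite sum_n_m_const; lra.
- rewrite S_INR, Rmult_plus_distr_r, Rmult_1_l.
  apply Rle_trans with (sum_n_m (fun n => Rabs (b n - b (n - 2 * i)%nat)
                                     + x (n - 2 * S i)%nat) m (2 * m)).
  + apply sumR_le; intros n Hn; unfold x.
    replace (n - 2 * S i + 2)%nat with (n - 2 * i)%nat by lia.
    replace (b n - b (n - 2 * S i)%nat) with
      ((b n - b (n - 2 * i)%nat) + - (b (n - 2 * S i)%nat - b (n - 2 * i)%nat)) by ring.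
    eapply Rle_trans; [apply Rabs_triang|]. rewrite Rabs_Ropp; lra.
  + rewrite sumR_plus; apply Rplus_le_compat; [apply IH; lia|].
    eapply Rle_trans; [apply sumR_shift_le; auto; lia|].
    apply sumR_subset; auto; lia.
Qed.

(** [cos_poly_test] contains [b n] with the total weight [1 + 1/2 + ... + 1/N],
    if each [b (n - 2 i)] is replaced by [b n]; summed over a block of [n], the
    cost of the replacement is at most [N] times the variation of [b], because
    the weight [1/i] cancels the number [i] of steps. *)
Lemma sum_abs_le_RInt (b : nat -> R) m N : (1 <= m)%nat -> (4 * N <= m)%nat ->
  ln (INR N + 1) * sum_n_m (fun n => Rabs (b n)) m (2 * m) <=
  3 * sum_n_m (fun n => RInt (fun x => Rabs (cos_poly b n x)) (- PI) PI) m (2 * m)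
  + INR N * sum_n_m (fun k => Rabs (b k - b (k + 2)%nat)) 0 (2 * m).
Proof.
intros Hm HN.
set (J n := RInt (fun x => Rabs (cos_poly b n x)) (- PI) PI : R).
set (S := sum_n_m (fun k => Rabs (b k - b (k + 2)%nat)) 0 (2 * m) : R).
assert (Hpos : forall i, (1 <= i)%nat -> 0 < / INR i).
{ intros; apply Rinv_0_lt_compat, lt_0_INR; lia. }
apply Rle_trans with (sum_n_m (fun n => 3 * J n +
  sum_n_m (fun i => / INR i * Rabs (b n - b (n - 2 * i)%nat)) 1 N) m (2 * m)).
- rewrite <- sumR_scal; apply sumR_le; intros n Hn.
  apply Rle_trans with (sum_n_m (fun i => / INR i) 1 N * Rabs (b n)).
  { apply Rmult_le_compat_r; [apply Rabs_pos|apply harmonic_ge_ln]. }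
  set (h := sum_n_m (fun i => / INR i) 1 N : R).
  assert (Hh : 0 <= h) by (apply sumR_ge0; intros; apply Rlt_le, Hpos; lia).
  assert (Ht := cos_poly_test b n N ltac:(lia)). fold (J n) in Ht.
  set (s := sum_n_m (fun i => b (n - 2 * i)%nat / INR i) 1 N : R) in *.
  rewrite <- (Rabs_right h) by lra. rewrite <- Rabs_mult.
  replace (h * b n) with (s + (h * b n - s)) by ring.
  eapply Rle_trans; [apply Rabs_triang|]. apply Rplus_le_compat; [exact Ht|].
  replace (h * b n - s) with
    (sum_n_m (fun i => / INR i * (b n - b (n - 2 * i)%nat)) 1 N : R).
  + eapply Rle_trans; [apply sumR_abs|].
    apply sumR_le; intros i Hi.
    rewrite Rabs_mult, (Rabs_right (/ INR i)); [lra|].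
    apply Rle_ge, Rlt_le, Hpos; lia.
  + unfold Rminus; rewrite <- (Rmult_1_l s), Ropp_mult_distr_l, (Rmult_comm h).
    unfold s, h; rewrite <- !sumR_scal, <- sumR_plus.
    apply sum_n_m_ext; intros i; apply Rminus_diag_uniq; unfold Rdiv; ring.
- rewrite sumR_plus, sumR_scal; apply Rplus_le_compat_l.
  rewrite sumR_swap.
  apply Rle_trans with (sum_n_m (fun _ => S) 1 N).
  + apply sumR_le; intros i Hi; rewrite sumR_scal.
    assert (H := sum_shift_diff_le b m i ltac:(lia)); fold S in H.
    apply Rle_trans with (/ INR i * (INR i * S)).
    * apply Rmult_le_compat_l; [apply Rlt_le, Hpos; lia|exact H].
    * rewrite <- Rmult_assoc, Rinv_l, Rmult_1_l; [lra|].
      apply not_0_INR; lia.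
  + rewrite sum_n_m_const; replace (Datatypes.S N - 1)%nat with N by lia; lra.
Qed.

Lemma ln_quarter (m : nat) : (16 <= m)%nat ->
  ln (INR m) <= 2 * ln (INR (m / 4) + 1).
Proof.
intros Hm.
assert (H : INR m <= 4 * (INR (m / 4) + 1)).
{ replace (4 * (INR (m / 4) + 1)) with (INR (4 * (m / 4 + 1)))
    by (rewrite mult_INR, plus_INR; simpl; ring).
  apply le_INR. assert (E := Nat.div_mod_eq m 4).
  assert (L := Nat.mod_upper_bound m 4). lia. }
assert (H4 : 4 <= INR (m / 4) + 1).
{ replace 4 with (INR 3 + 1) by (simpl; ring).
  apply Rplus_le_compat_r, le_INR.
  assert (E := Nat.div_mod_eq m 4). assert (L := Nat.mod_upper_bound m 4). lia. }
assert (0 < INR m) by (apply lt_0_INR; lia).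
apply (ln_le_pow 2); try lra.
set (q := INR (m / 4) + 1) in *. simpl. nra.
Qed.

(** [sum_abs_le_RInt] with [N] about [m/4], for which [ln N] is comparable with
    [ln m]. Mere boundedness of the two quantities in the hypotheses makes the
    variation of [k p_k] over the block of order [m / ln m], which is enough
    for its contribution to be negligible. *)
Lemma log_mean_lim_of_cos_poly (p : nat -> R) E :
  (exists M, forall m, (M <= m)%nat -> ln (INR m) *
     sum_n_m (fun k => Rabs (p k - p (k + 2)%nat)) m (2 * m - 1) <= E) ->
  (forall m, (2 <= m)%nat -> log_mean (fun k => Rabs (p k)) m <= E) ->
  is_lim_seq (fun n => / (INR n + 1) *
    RInt (fun x => Rabs (cos_poly (fun k => INR k * p k) n x)) (- PI) PI) 0 ->
  is_lim_seq (log_mean (fun k => Rabs (p k))) 0.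
Proof.
intros [M HT] HB HJ.
set (b k := INR k * p k) in *.
set (x k := Rabs (b k - b (k + 2)%nat)).
set (J n := RInt (fun x => Rabs (cos_poly b n x)) (- PI) PI : R).
assert (Hx : forall k, 0 <= x k) by (intros; apply Rabs_pos).
assert (Hvar : is_lim_seq (fun n => sum_n_m x 0 n / (INR n + 1)) 0).
{ apply dyadic_sum; auto.
  assert (Hln : is_lim_seq (fun m => 5 * E * / ln (INR m)) 0).
  { replace (Finite 0) with (Rbar_mult (5 * E) 0) by (simpl; f_equal; ring).
    apply is_lim_seq_scal_l.
    apply (is_lim_seq_inv _ p_infty); [|discriminate].
    apply (is_lim_comp_seq _ _ p_infty); [apply is_lim_ln_p|now exists 0%nat|].
    apply is_lim_seq_INR. }
  (* 5 = 3 + 2, the constants of [block_var_le] *)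
  apply (is_lim_seq_0_le _ _ (M + 2)) with (2 := Hln); intros m Hm.
  assert (Hm2 : 2 <= INR m) by (apply (le_INR 2); lia).
  assert (Hl : 0 < ln (INR m)) by (rewrite <- ln_1; apply ln_increasing; lra).
  assert (Hv := block_var_le p m ltac:(lia)); cbv zeta in Hv; fold b x in Hv.
  specialize (HT m ltac:(lia)). specialize (HB m ltac:(lia)).
  rewrite Rabs_right by (apply Rle_ge, Rdiv_le_0_compat; [apply sumR_ge0; auto|lra]).
  apply Rmult_le_reg_r with (INR m); [lra|].
  apply Rmult_le_reg_l with (ln (INR m)); auto.
  unfold Rdiv; rewrite (Rmult_assoc _ (/ INR m)), Rinv_l, Rmult_1_r by lra.
  replace (ln (INR m) * (5 * E * / ln (INR m) * INR m)) with (INR m * (5 * E))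
    by (field; lra).
  apply Rle_trans with (1 := Hv). apply Rmult_le_compat_l; lra. }
apply is_lim_seq_0; intros eps He.
destruct (proj1 (is_lim_seq_0 _) HJ (eps / 38) ltac:(lra)) as [N1 HN1].
destruct (proj1 (is_lim_seq_0 _) Hvar (eps / 38) ltac:(lra)) as [N2 HN2].
(* 38 = 2 (3 * 6 + 1): the sum of the norms is at most 6 e m^2 and enters with
   the factor 3, the variation contributes e m^2, and ln m <= 2 ln (m/4 + 1) *)
exists (N1 + N2 + 16)%nat; intros m Hm.
rewrite Rabs_right by (apply Rle_ge, log_mean_ge0; intros; apply Rabs_pos).
assert (Hm1 : 1 <= INR m) by (apply INR_ge1; lia).
assert (Hmain := sum_abs_le_RInt b m (m / 4) ltac:(lia) ltac:(apply Nat.Div0.mul_div_le)).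
assert (Hq := ln_quarter m ltac:(lia)).
fold x in Hmain.
set (l := ln (INR (m / 4) + 1)) in *.
assert (Hl : 0 <= ln (INR m)) by now apply ln_ge0.
assert (H4 : INR (m / 4) <= INR m / 4).
{ assert (INR (4 * (m / 4)) <= INR m) by (apply le_INR, Nat.Div0.mul_div_le).
  rewrite mult_INR in H; simpl (INR 4) in H; lra. }
assert (H40 := pos_INR (m / 4)).
assert (HSJ : sum_n_m J m (2 * m) <= (INR m + 1) * (eps / 38 * (2 * INR m + 1))).
{ apply Rle_trans with (sum_n_m (fun _ => eps / 38 * (2 * INR m + 1)) m (2 * m)).
  - apply sumR_le; intros n Hn.
    assert (Hn1 : INR n <= 2 * INR m).
    { change 2 with (INR 2); rewrite <- mult_INR; apply le_INR; lia. }
    assert (Hn0 := pos_INR n).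
    assert (HJn := HN1 n ltac:(lia)).
    apply Rle_trans with (eps / 38 * (INR n + 1)); [|apply Rmult_le_compat_l; lra].
    apply Rmult_le_reg_l with (/ (INR n + 1)); [apply Rinv_0_lt_compat; lra|].
    replace (/ (INR n + 1) * (eps / 38 * (INR n + 1))) with (eps / 38) by (field; lra).
    apply Rle_trans with (1 := Rle_abs _). exact HJn.
  - rewrite sum_n_m_const; replace (S (2 * m) - m)%nat with (S m) by lia.
    rewrite S_INR; lra. }
assert (HSx : sum_n_m x 0 (2 * m) <= eps / 38 * (2 * INR m + 1)).
{ assert (H := HN2 (2 * m)%nat ltac:(lia)).
  rewrite mult_INR in H; simpl (INR 2) in H; replace (1 + 1) with 2 in H by ring.
  apply Rmult_le_reg_r with (/ (2 * INR m + 1)); [apply Rinv_0_lt_compat; lra|].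
  rewrite Rmult_assoc, Rinv_r, Rmult_1_r by lra.
  apply Rle_trans with (1 := Rle_abs _). exact H. }
assert (Hbp : INR m * sum_n_m (fun k => Rabs (p k)) m (2 * m) <=
              sum_n_m (fun k => Rabs (b k)) m (2 * m)).
{ rewrite <- sumR_scal; apply sumR_le; intros k Hk; unfold b.
  rewrite Rabs_mult, (Rabs_right (INR k)) by apply Rle_ge, pos_INR.
  apply Rmult_le_compat_r; [apply Rabs_pos|apply le_INR; lia]. }
unfold log_mean.
set (P := sum_n_m (fun k => Rabs (p k)) m (2 * m) : R) in *.
set (B := sum_n_m (fun k => Rabs (b k)) m (2 * m) : R) in *.
set (SJ := sum_n_m J m (2 * m) : R) in *.
change (sum_n_m _ m (2 * m)) with SJ in Hmain.
set (Sx := sum_n_m x 0 (2 * m) : R) in *.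
assert (HP : 0 <= P) by (apply sumR_ge0; intros; apply Rabs_pos).
assert (HSx0 : 0 <= Sx) by (apply sumR_ge0; auto).
assert (HB0 : 0 <= INR m * P) by (apply Rmult_le_pos; lra).
set (t := INR m) in *. set (e := eps / 38) in *.
assert (K1 : (t + 1) * (e * (2 * t + 1)) <= 6 * e * (t * t)).
{ assert (0 <= e) by (unfold e; lra).
  assert (Q : (t + 1) * (2 * t + 1) <= 6 * (t * t)) by nra.
  apply (Rmult_le_compat_l e) in Q; lra. }
assert (K2 : INR (m / 4) * Sx <= e * (t * t)).
{ apply Rle_trans with (t / 4 * (e * (2 * t + 1))).
  - apply Rmult_le_compat; lra.
  - assert (0 <= e) by (unfold e; lra).
    assert (Q : t / 4 * (2 * t + 1) <= t * t) by nra.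
    apply (Rmult_le_compat_l e) in Q; lra. }
assert (K3 : ln t * (t * P) <= 2 * (19 * e * (t * t))).
{ apply Rle_trans with (2 * l * (t * P)); [apply Rmult_le_compat_r; lra|].
  assert (l * (t * P) <= l * B) by (apply Rmult_le_compat_l; lra). lra. }
apply Rmult_le_reg_r with (t * t); [nra|].
replace (ln t / t * P * (t * t)) with (ln t * (t * P)) by (field; lra).
replace (eps * (t * t)) with (2 * (19 * e * (t * t))) by (unfold e; field). exact K3.
Qed.

(** * The norm of V_n - S_n *)

Lemma Re_sum (f : nat -> C) m n :
  Re (sum_n_m f m n) = sum_n_m (fun k => Re (f k)) m n :> R.
Proof.
sum_induction m n; auto.
- now rewrite sum_n_m_zero.
- rewrite sum_n_Sm by auto; simpl; rewrite <- IH; reflexivity.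
- now rewrite sum_n_n.
Qed.

Lemma Im_sum (f : nat -> C) m n :
  Im (sum_n_m f m n) = sum_n_m (fun k => Im (f k)) m n :> R.
Proof.
sum_induction m n; auto.
- now rewrite sum_n_m_zero.
- rewrite sum_n_Sm by auto; simpl; rewrite <- IH; reflexivity.
- now rewrite sum_n_n.
Qed.

Lemma S_cos_succ a n x :
  S_cos a (S n) x = (S_cos a n x + a (S n) * cos (INR (S n) * x))%C.
Proof.
unfold S_cos; rewrite sum_n_Sm by lia.
change (@plus C_AbelianMonoid) with Cplus; now rewrite Cplus_assoc.
Qed.

(** The term of index [k] occurs in [n + 1 - k] of the partial sums averaged
    by [V_n]. *)
Lemma V_minus_S a n x :
  ((INR n + 1) * (V_cos a n x - S_cos a n x) =
   - sum_n_m (fun k => (INR k * cos (INR k * x)) * a k) 0 n)%C.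
Proof.
assert (Hn : (INR n + 1)%C <> 0).
{ rewrite <- RtoC_plus; intros H; apply RtoC_inj in H; assert (H1 := pos_INR n); lra. }
transitivity (sum_n (fun k => S_cos a k x) n - (INR n + 1) * S_cos a n x)%C.
{ unfold V_cos; field; exact Hn. }
clear Hn; induction n as [|n IH].
- rewrite sum_O, sum_n_n; simpl; ring.
- rewrite sum_Sn, sum_n_Sm by lia.
  change (@plus C_AbelianMonoid) with Cplus.
  rewrite Copp_plus_distr, <- IH, S_cos_succ, S_INR, !RtoC_plus. ring.
Qed.

Definition re_coef (a : nat -> C) (k : nat) : R := INR k * Re (a k).
Definition im_coef (a : nat -> C) (k : nat) : R := INR k * Im (a k).

Lemma Cmod_V_minus_S a n x :
  Cmod (V_cos a n x - S_cos a n x) =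
  / (INR n + 1) * Cmod (cos_poly (re_coef a) n x, cos_poly (im_coef a) n x).
Proof.
assert (Hn := pos_INR n).
apply Rmult_eq_reg_l with (INR n + 1); [|lra].
rewrite <- Rmult_assoc, Rinv_r, Rmult_1_l by lra.
transitivity (Cmod ((INR n + 1) * (V_cos a n x - S_cos a n x))%C).
{ rewrite Cmod_mult, <- RtoC_plus, Cmod_R, Rabs_right; lra. }
rewrite V_minus_S, Cmod_opp; f_equal.
apply injective_projections; simpl.
- change (Re (sum_n_m (fun k => (INR k * cos (INR k * x)) * a k)%C 0 n)
          = cos_poly (re_coef a) n x).
  rewrite Re_sum; apply sum_n_m_ext; intros k; unfold re_coef, Re.
  apply Rminus_diag_uniq; simpl; ring.
- change (Im (sum_n_m (fun k => (INR k * cos (INR k * x)) * a k)%C 0 n)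
          = cos_poly (im_coef a) n x).
  rewrite Im_sum; apply sum_n_m_ext; intros k; unfold im_coef, Im.
  apply Rminus_diag_uniq; simpl; ring.
Qed.

Lemma Cmod_le_sum (z : C) : Cmod z <= Rabs (Re z) + Rabs (Im z).
Proof.
destruct z as [u v]; simpl.
replace (u, v) with (RtoC u + Ci * RtoC v)%C
  by (apply injective_projections; simpl; ring).
eapply Rle_trans; [apply Cmod_triangle|].
rewrite Cmod_mult, !Cmod_R, Cmod_Ci; lra.
Qed.

Lemma im_le_Cmod (z : C) : Rabs (Im z) <= Cmod z.
Proof. apply Rle_trans with (2 := Rmax_Cmod z), Rmax_r. Qed.

Definition poly_norm (b : nat -> R) (n : nat) : R :=
  / (INR n + 1) * RInt (fun x => Rabs (cos_poly b n x)) (- PI) PI.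

Lemma L1norm_bounds a n :
  let L := 2 * PI * L1norm (fun x => (V_cos a n x - S_cos a n x)%C) in
  0 <= poly_norm (re_coef a) n <= L /\ 0 <= poly_norm (im_coef a) n <= L /\
  L <= poly_norm (re_coef a) n + poly_norm (im_coef a) n.
Proof.
intros L. assert (HP := PI_RGT_0). assert (Hn := pos_INR n).
assert (Hi : 0 < / (INR n + 1)) by (apply Rinv_0_lt_compat; lra).
set (u := cos_poly (re_coef a) n). set (v := cos_poly (im_coef a) n).
assert (HL : is_RInt (fun x => / (INR n + 1) * Cmod (u x, v x)) (- PI) PI L).
{ replace L with (RInt (fun x => / (INR n + 1) * Cmod (u x, v x)) (- PI) PI : R).
  - apply is_RInt_cont; intros x.
    apply (continuous_mult (K := R_AbsRing)); [apply continuous_const|].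
    apply (continuous_comp (fun y => u y ^ 2 + v y ^ 2) sqrt); [|apply continuous_sqrt].
    apply (continuous_plus (V := R_NormedModule));
      (apply (continuous_mult (K := R_AbsRing)); [|apply (continuous_mult (K := R_AbsRing));
        [|apply continuous_const]]); apply continuous_cos_poly.
  - unfold L, L1norm; rewrite <- Rmult_assoc, Rinv_r, Rmult_1_l by lra.
    apply RInt_ext; intros x _; now rewrite Cmod_V_minus_S. }
assert (HI : forall b, is_RInt (fun x => / (INR n + 1) * Rabs (cos_poly b n x))
   (- PI) PI (poly_norm b n)).
{ intros b; apply is_RInt_scalR, is_RInt_cont; intros y.
  apply continuous_Rabs_comp, continuous_cos_poly. }
assert (Hpos : forall b, 0 <= poly_norm b n).
{ intros b; rewrite <- (is_RInt_unique _ _ _ _ (HI b)).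
  apply RInt_ge_0; [lra|eexists; apply HI|].
  intros x _; apply Rmult_le_pos; [lra|apply Rabs_pos]. }
repeat split; auto.
- apply (is_RInt_le _ _ (- PI) PI _ _ ltac:(lra) (HI _) HL); intros x _.
  apply Rmult_le_compat_l; [lra|]. apply (re_le_Cmod (u x, v x)).
- apply (is_RInt_le _ _ (- PI) PI _ _ ltac:(lra) (HI _) HL); intros x _.
  apply Rmult_le_compat_l; [lra|]. apply (im_le_Cmod (u x, v x)).
- apply (is_RInt_le _ _ (- PI) PI _ _ ltac:(lra) HL (is_RInt_plusR _ _ _ _ _ _ (HI _) (HI _))).
  intros x _; rewrite <- Rmult_plus_distr_l.
  apply Rmult_le_compat_l; [lra|]. apply (Cmod_le_sum (u x, v x)).
Qed.

(** * The class GM6 *)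

Definition log_var (a : nat -> C) (m : nat) : R :=
  ln (INR m) * sum_n_m (fun k => Cmod (a k - a (k + 2)%nat)%C) m (2 * m - 1).

Lemma log_var_ge0 a m : (1 <= m)%nat -> 0 <= log_var a m.
Proof.
intros Hm; apply Rmult_le_pos; [now apply ln_ge0, INR_ge1|].
apply sumR_ge0; intros; apply Cmod_ge_0.
Qed.

Lemma GM6_log_mean_bounded r a : GM6 r a ->
  exists E, forall m, (2 <= m)%nat -> log_mean (fun k => Cmod (a k)) m <= E.
Proof.
intros [c [Hc [Hfin _]]].
specialize (Hfin 2%nat (le_n 2)); unfold beta6_sup in Hfin.
destruct (Lub_Rbar_correct (beta6_values c a 2)) as [Hub _].
rewrite <- Hfin in Hub.
exists (real (Lub_Rbar (beta6_values c a 2))); intros m Hm.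
apply (Hub (log_mean (fun k => Cmod (a k)) m)); exists m; repeat split; [lia|].
apply le_IZR, Rle_trans with (INR 2 / c); [apply base_Int_part|].
rewrite <- INR_IZR_INZ. apply Rle_trans with (INR 2); [|now apply le_INR].
apply Rmult_le_reg_r with c; [lra|]. unfold Rdiv.
rewrite Rmult_assoc, Rinv_l by lra; simpl; lra.
Qed.

(** The supremum in the definition of the class only sees the indices from
    [n/c] on, so a bound on them, wherever it starts, is inherited by the
    variation over all late blocks. *)
Lemma GM6_log_var a : GM6 2 a ->
  exists K, 0 <= K /\ forall E J,
    (forall m, (J <= m)%nat -> log_mean (fun k => Cmod (a k)) m <= E) ->
    exists N, forall n, (N <= n)%nat -> log_var a n <= K * E.
Proof.
intros [c [Hc [Hfin [K HK]]]].
exists (Rabs K); split; [apply Rabs_pos|]; intros E J HJ.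
destruct (nfloor_ex (c * (INR J + 1))) as [N [_ HN]].
{ apply Rmult_le_pos; [lra|]. assert (H := pos_INR J); lra. }
exists (N + J + 2)%nat; intros n Hn.
assert (Hn2 : 2 <= INR n) by (apply (le_INR 2); lia).
assert (Hl : 0 < ln (INR n)) by (rewrite <- ln_1; apply ln_increasing; lra).
assert (HnN : INR N + 1 <= INR n).
{ rewrite <- S_INR; apply le_INR; lia. }
assert (Hnc : INR J + 1 <= INR n / c).
{ apply Rmult_le_reg_l with c; [lra|].
  replace (c * (INR n / c)) with (INR n) by (field; lra). lra. }
assert (Hncn : INR n / c <= INR n).
{ apply Rmult_le_reg_l with c; [lra|].
  replace (c * (INR n / c)) with (INR n) by (field; lra). nra. }
destruct (base_Int_part (INR n / c)) as [HI1 HI2].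
set (y := real (beta6_sup c a n)).
assert (Hy : 0 <= y <= E).
{ specialize (Hfin n ltac:(lia)); unfold y, beta6_sup in *.
  destruct (Lub_Rbar_correct (beta6_values c a n)) as [Hub Hlub].
  rewrite <- Hfin in Hub, Hlub; split.
  - apply Rle_trans with (log_mean (fun k => Cmod (a k)) n).
    + apply log_mean_ge0; intros; apply Cmod_ge_0.
    + apply (Hub (log_mean (fun k => Cmod (a k)) n)).
      exists n; repeat split; [lia|].
      apply le_IZR; rewrite <- INR_IZR_INZ; lra.
  - apply (Hlub (Finite E)); intros z [m [Hm1 [Hm2 ->]]].
    apply (HJ m). apply IZR_le in Hm2; rewrite <- INR_IZR_INZ in Hm2.
    apply INR_le; lra. }
unfold log_var.
apply Rle_trans with (ln (INR n) * (K * beta6 c a n)).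
- apply Rmult_le_compat_l; [lra|]. apply HK; lia.
- unfold beta6; fold y.
  replace (ln (INR n) * (K * (/ ln (INR n) * y))) with (K * y) by (field; lra).
  apply Rle_trans with (Rabs K * y).
  + apply Rmult_le_compat_r; [lra|apply Rle_abs].
  + apply Rmult_le_compat_l; [apply Rabs_pos|lra].
Qed.

Lemma GM6_log_var_lim a : GM6 2 a ->
  is_lim_seq (log_mean (fun k => Cmod (a k))) 0 -> is_lim_seq (log_var a) 0.
Proof.
intros ha H; destruct (GM6_log_var a ha) as [K [HK HT]].
apply is_lim_seq_0; intros eps He.
assert (He' : 0 < eps / (K + 1)) by (apply Rdiv_lt_0_compat; lra).
destruct (proj1 (is_lim_seq_0 _) H _ He') as [J HJ].
destruct (HT (eps / (K + 1)) J) as [N HN].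
{ intros m Hm; apply Rle_trans with (1 := Rle_abs _); auto. }
exists (N + 1)%nat; intros n Hn.
rewrite Rabs_right by (apply Rle_ge, log_var_ge0; lia).
apply Rle_trans with (1 := HN n ltac:(lia)).
replace eps with ((K + 1) * (eps / (K + 1))) at 2 by (field; lra). nra.
Qed.

(** A term differs from those of the same parity in its block by at most the
    variation over the block, hence from their mean. *)
Lemma Cmod_log_le a n : (1 <= n)%nat ->
  Cmod (a n) * ln (INR n) <= 2 * log_mean (fun k => Cmod (a k)) n + log_var a n.
Proof.
intros Hn.
assert (Hn1 : 1 <= INR n) by now apply INR_ge1.
assert (Hl := ln_ge0 _ Hn1).
set (d k := Cmod (a k - a (k + 2)%nat)%C).
set (T := sum_n_m d n (2 * n - 1) : R).
assert (Hd : forall k, 0 <= d k) by (intros; apply Cmod_ge_0).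
set (N := (n / 2)%nat).
assert (HN : (2 * N <= n /\ n <= 2 * N + 1)%nat).
{ assert (E := Nat.div_mod_eq n 2). assert (L := Nat.mod_upper_bound n 2). unfold N; lia. }
assert (Hstep : forall i, (i <= N)%nat -> Cmod (a n) <= Cmod (a (n + 2 * i)%nat) + T).
{ intros i Hi.
  assert (H : Cmod (a n - a (n + 2 * i)%nat)%C <= T).
  { destruct i as [|i].
    - replace (n + 2 * 0)%nat with n by lia.
      replace (a n - a n)%C with (RtoC 0) by ring.
      rewrite Cmod_0; apply sumR_ge0; auto.
    - apply Rle_trans with (sum_n_m (fun l => d (n + 2 * l)%nat) 0 i).
      + clear Hi; induction i as [|i IH].
        * rewrite sumR_one; unfold d.
          replace (n + 2 * 0)%nat with n by lia. apply Rle_refl.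
        * rewrite sumR_S by lia.
          replace (a n - a (n + 2 * S (S i))%nat)%C with
            ((a n - a (n + 2 * S i)%nat) + (a (n + 2 * S i)%nat - a (n + 2 * S i + 2)%nat))%C.
          -- eapply Rle_trans; [apply Cmod_triangle|]. unfold d at 2; lra.
          -- replace (n + 2 * S i + 2)%nat with (n + 2 * S (S i))%nat by lia. ring.
      + eapply Rle_trans; [apply sumR_step2_le; auto|].
        apply sumR_subset; auto; lia. }
  replace (a n) with (a (n + 2 * i)%nat + (a n - a (n + 2 * i)%nat))%C by ring.
  eapply Rle_trans; [apply Cmod_triangle|]. lra. }
assert (Hsum : INR (S N) * (Cmod (a n) - T) <= sum_n_m (fun k => Cmod (a k)) n (2 * n)).
{ apply Rle_trans with (sum_n_m (fun i => Cmod (a (n + 2 * i)%nat)) 0 N).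
  - replace (S N) with (S N - 0)%nat by lia.
    rewrite <- sum_n_m_const; apply sumR_le; intros i Hi.
    specialize (Hstep i ltac:(lia)); lra.
  - eapply Rle_trans; [apply (sumR_step2_le (fun k => Cmod (a k)))|].
    + intros; apply Cmod_ge_0.
    + apply sumR_subset; try lia; intros; apply Cmod_ge_0. }
assert (HSN : INR n <= 2 * INR (S N)).
{ change 2 with (INR 2); rewrite <- mult_INR; apply le_INR; lia. }
unfold log_mean, log_var; fold d; fold T.
set (P := sum_n_m (fun k => Cmod (a k)) n (2 * n) : R) in *.
assert (HP : 0 <= P) by (apply sumR_ge0; intros; apply Cmod_ge_0).
assert (H : Cmod (a n) - T <= 2 * P / INR n).
{ destruct (Rle_dec (Cmod (a n) - T) 0) as [Hneg|Hpos].
  - apply Rle_trans with (1 := Hneg). apply Rdiv_le_0_compat; lra.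
  - apply Rmult_le_reg_r with (INR n); [lra|].
    replace (2 * P / INR n * INR n) with (2 * P) by (field; lra). nra. }
apply Rle_trans with ((2 * P / INR n + T) * ln (INR n)).
- apply Rmult_le_compat_r; lra.
- right; field; lra.
Qed.

Lemma log_var_part (f : C -> R) a m :
  (forall u v, Rabs (f u - f v) <= Cmod (u - v)%C) -> (1 <= m)%nat ->
  0 <= ln (INR m) *
    sum_n_m (fun k => Rabs (f (a k) - f (a (k + 2)%nat))) m (2 * m - 1) <= log_var a m.
Proof.
intros Hf Hm. assert (Hl := ln_ge0 _ (INR_ge1 _ Hm)). split.
- apply Rmult_le_pos; auto. apply sumR_ge0; intros; apply Rabs_pos.
- apply Rmult_le_compat_l; auto. apply sumR_le; auto.
Qed.

Lemma Re_Lipschitz u v : Rabs (Re u - Re v) <= Cmod (u - v)%C.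
Proof. exact (re_le_Cmod (u - v)%C). Qed.

Lemma Im_Lipschitz u v : Rabs (Im u - Im v) <= Cmod (u - v)%C.
Proof. exact (im_le_Cmod (u - v)%C). Qed.

(** * The equivalence *)

Theorem mainTheorem5 (a : nat -> C) (ha : GM6 2 a) :
  is_lim_seq (fun n => L1norm (fun x => (V_cos a n x - S_cos a n x)%C)) 0 <->
  is_lim_seq (fun n => Cmod (a n) * ln (INR n)) 0.
Proof.
assert (HP := PI_RGT_0).
set (L n := L1norm (fun x => (V_cos a n x - S_cos a n x)%C)).
split; intros H.
- assert (HL : is_lim_seq (fun n => 2 * PI * L n + 0 * L n) 0)
    by now apply is_lim_seq_0_lin.
  destruct (GM6_log_mean_bounded 2 a ha) as [E HE].
  destruct (GM6_log_var a ha) as [K [HK HT]].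
  destruct (HT E 2%nat HE) as [N HN].
  assert (HE0 : 0 <= E).
  { apply Rle_trans with (2 := HE 2%nat (le_n 2)), log_mean_ge0; intros; apply Cmod_ge_0. }
  assert (HKE : 0 <= K * E) by now apply Rmult_le_pos.
  assert (Hpart : forall f : C -> R,
    (forall u v, Rabs (f u - f v) <= Cmod (u - v)%C) ->
    (forall u, Rabs (f u) <= Cmod u) ->
    is_lim_seq (poly_norm (fun k => INR k * f (a k))) 0 ->
    is_lim_seq (log_mean (fun k => Rabs (f (a k)))) 0).
  { intros f Hf Hf0 Hlim.
    apply (log_mean_lim_of_cos_poly (fun k => f (a k)) (K * E + E)).
    - exists (N + 1)%nat; intros m Hm.
      apply Rle_trans with (log_var a m); [apply log_var_part; auto; lia|].
      specialize (HN m ltac:(lia)); lra.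
    - intros m Hm. apply Rle_trans with (log_mean (fun k => Cmod (a k)) m).
      + apply log_mean_le; auto; lia.
      + specialize (HE m Hm); lra.
    - exact Hlim. }
  assert (Hre : is_lim_seq (log_mean (fun k => Rabs (Re (a k)))) 0).
  { apply Hpart; [apply Re_Lipschitz|apply re_le_Cmod|].
    apply (is_lim_seq_0_le _ _ 0) with (2 := HL); intros n _.
    destruct (L1norm_bounds a n) as [B _]; fold (L n) in B.
    unfold re_coef in B; rewrite Rabs_right; lra. }
  assert (Him : is_lim_seq (log_mean (fun k => Rabs (Im (a k)))) 0).
  { apply Hpart; [apply Im_Lipschitz|apply im_le_Cmod|].
    apply (is_lim_seq_0_le _ _ 0) with (2 := HL); intros n _.
    destruct (L1norm_bounds a n) as [_ [B _]]; fold (L n) in B.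
    unfold im_coef in B; rewrite Rabs_right; lra. }
  assert (Hmean : is_lim_seq (log_mean (fun k => Cmod (a k))) 0).
  { apply (is_lim_seq_0_le _ _ 1) with (2 := is_lim_seq_0_lin _ _ 1 1 Hre Him); intros m Hm.
    rewrite Rabs_right by (apply Rle_ge, log_mean_ge0; intros; apply Cmod_ge_0).
    rewrite !Rmult_1_l; unfold log_mean; rewrite <- Rmult_plus_distr_l, <- sumR_plus.
    apply (log_mean_le _ _ m Hm); intros k; apply Cmod_le_sum. }
  apply (is_lim_seq_0_le _ _ 1) with
    (2 := is_lim_seq_0_lin _ _ 2 1 Hmean (GM6_log_var_lim a ha Hmean)); intros n Hn.
  rewrite Rabs_right, Rmult_1_l; [now apply Cmod_log_le|].
  apply Rle_ge, Rmult_le_pos; [apply Cmod_ge_0|now apply ln_ge0, INR_ge1].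
- assert (Hvar := GM6_log_var_lim a ha (log_mean_lim _ (fun k => Cmod_ge_0 (a k)) H)).
  assert (Hpart : forall f : C -> R,
    (forall u v, Rabs (f u - f v) <= Cmod (u - v)%C) ->
    (forall u, Rabs (f u) <= Cmod u) ->
    is_lim_seq (poly_norm (fun k => INR k * f (a k))) 0).
  { intros f Hf Hf0; apply (cos_poly_lim_of_log (fun k => f (a k))).
    - apply (is_lim_seq_0_le _ _ 1) with (2 := Hvar); intros m Hm.
      assert (B := log_var_part f a m Hf Hm). rewrite Rabs_right; lra.
    - apply (is_lim_seq_0_le _ _ 1) with (2 := H); intros m Hm.
      assert (Hl := ln_ge0 _ (INR_ge1 _ Hm)).
      rewrite Rabs_mult, Rabs_Rabsolu, (Rabs_right (ln _)) by lra.
      now apply Rmult_le_compat_r. }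
  assert (Hre := Hpart Re Re_Lipschitz re_le_Cmod).
  assert (Him := Hpart Im Im_Lipschitz im_le_Cmod).
  apply (is_lim_seq_0_le _ _ 0) with
    (2 := is_lim_seq_0_lin _ _ (/ (2 * PI)) (/ (2 * PI)) Hre Him); intros n _.
  destruct (L1norm_bounds a n) as [B1 [_ B2]]; fold (L n) in B1, B2.
  unfold re_coef, im_coef in B1, B2.
  assert (Hi : 0 < / (2 * PI)) by (apply Rinv_0_lt_compat; lra).
  assert (HL0 : 0 <= L n).
  { apply Rmult_le_reg_l with (2 * PI); lra. }
  rewrite Rabs_right by lra.
  rewrite <- Rmult_plus_distr_l.
  apply Rmult_le_reg_l with (2 * PI); [lra|].
  rewrite <- Rmult_assoc, Rinv_r, Rmult_1_l by lra. lra.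
Qed.
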